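(* Let $\mathcal{P}$ be a finite classical polar space of rank $d$ and parameter $e$, defined over $\mathbb{F}_{q}$. For each $a$ with $1 \leq a \leq d-1$, and all $r,i$ with $0\le r\le a$ and $0\le i\le\min(r,d-a)$, the eigenvalue of the relation $R_{a,a}^{a-1,a}$ on $V_{r,i}^{a}$ is $$\mu_{d,a,a-1,a,r,i}={a-r \brack 1}_q q^{2d-2a+e} - \left( {r \brack 1}_q - {i \brack 1}_q(q^{i-1+e}+1) \right)q^{d-a-i}.$$
   Context: All dimensions are vector space dimensions. A finite classical polar space $\mathcal{P}$ of rank $d\ge2$ over $\mathbb{F}_q$ consists of the totally isotropic (totally singular) subspaces of a non-degenerate quadratic or reflexive sesquilinear form; it is one of $\mathcal{Q}^+(2d-1,q)$, $\mathcal{H}(2d-1,q)$ ($q$ square), $\mathcal{W}(2d-1,q)$, $\mathcal{Q}(2d,q)$, $\mathcal{H}(2d,q)$ ($q$ square), $\mathcal{Q}^-(2d+1,q)$, with parameter $e=0,\frac12,1,1,\frac32,2$ respectively; each $(d-1)$-space lies in $q^e+1$ generators ($d$-spaces). $\Omega_a$ is the set of $a$-spaces (totally isotropic subspaces of dimension $a$), and $\perp$ denotes orthogonality with respect to the (associated) form. ${n\brack k}_q$ is the Gaussian binomial coefficient, so ${n\brack 1}_q=\frac{q^n-1}{q-1}$. $R_{a,b}^{s,k}=\{(\pi_a,\pi_b)\in\Omega_a\times\Omega_b : \dim(\pi_a\cap\pi_b)=s,\ \dim\langle\pi_a,\pi_b\cap\pi_a^\perp\rangle=k\}$. Thus $R_{a,a}^{a-1,a}$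 consists of the pairs of $a$-spaces meeting in an $(a-1)$-space and not spanning a totally isotropic subspace. $C_{a,b}^{s,k}$ is the corresponding $(0,1)$-matrix (rows indexed by $b$-spaces, columns by $a$-spaces), seen as a map $\mathbb{R}^{\Omega_a}\to\mathbb{R}^{\Omega_b}$, and $C_{a,b}$ is the incidence map ($C_{a,b}=C_{a,b}^{\min(a,b),\max(a,b)}$; it is $0$ if $a$ or $b$ is not in $\{0,\dots,d\}$). For $0\le r\le a$, $0\le i\le\min(r,d-a)$, $$V^a_{r,i}=\mathrm{Im}(C_{r,a})\cap\mathrm{Im}(C_{r-1,a})^\perp\cap\mathrm{Im}(C_{d-i,a})\cap\mathrm{Im}(C_{d-i+1,a})^\perp .$$ $\mathbb{R}^{\Omega_a}$ is the orthogonal direct sum of these subspaces, and each $V^a_{r,i}$ is contained in an eigenspace of $C_{a,a}^{s,k}$; $\mu_{d,a,s,k,r,i}$ denotes the eigenvalue of $C^{s,k}_{a,a}$ on $V^a_{r,i}$. *)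

(* Defs.v *)
From HB Require Import structures.
From mathcomp Require Import all_boot all_order all_algebra.
From mathcomp Require Import sesquilinear.
From mathcomp Require Import reals exp.

Set Implicit Arguments.
Unset Strict Implicit.
Unset Printing Implicit Defensive.

Import Order.TTheory GRing.Theory Num.Theory.
Local Open Scope ring_scope.

Section FiniteVspace.
Import VectorInternalTheory.
Variables (F : finFieldType) (vT : vectType F).
HB.instance Definition _ := [Countable of {vspace vT} by <:].
HB.instance Definition _ := [Finite of {vspace vT} by <:].
End FiniteVspace.

Section PolarSpaces.
Variables (F : finFieldType) (n : nat).
Notation V := 'rV[F]_n.

(* A quadratic form bundled with its polar form, which [quadD] determines. *)
Record quadratic_form := QuadraticForm {
  quad :> V -> F;
  polar : {symmetric V};
  quadZ : forall (c : F) (u : V), quad (c *: u) = c ^+ 2 * quad u;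
  quadD : forall u v : V, quad (u + v) = quad u + quad v + polar u v
}.

Inductive polar_form :=
| OfQuadratic of quadratic_form
| OfHermitian (theta : involutive_rmorphism F) of {hermitian_sym V for theta}
| OfAlternating of {skew_symmetric V}.

(* In characteristic 2 a nondegenerate quadratic form may have a degenerate
   polar form (it does exactly when n is odd); what is required is that
   the radical of the polar form contains no nonzero singular vector. *)
Definition nondegenerate_form (P : polar_form) : Prop :=
  match P with
  | OfQuadratic Q =>
      forall u : V, u \in orthov (polar Q) fullv -> Q u = 0 -> u = 0
  | OfHermitian theta f => is_unitary f /\ ~ (theta =1 id)
  | OfAlternating f => is_psymplectic f
  end.

Definition perp (P : polar_form) (U : {vspace V}) : {vspace V} :=
  match P with
  | OfQuadratic Q => orthov (polar Q) U
  | OfHermitian theta f => orthov f U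
  | OfAlternating f => orthov f U
  end.

(* Totally singular in the quadratic case, totally isotropic otherwise. *)
Definition tot_isotropic (P : polar_form) (U : {vspace V}) : bool :=
  match P with
  | OfQuadratic Q => [forall u : V, (u \in U) ==> (Q u == 0)]
  | OfHermitian _ _ | OfAlternating _ => (U <= perp P U)%VS
  end.

Definition polar_rank (P : polar_form) : nat :=
  \max_(U : {vspace V} | tot_isotropic P U) \dim U.

End PolarSpaces.

(* Q^+(2d-1,q), H(2d-1,q), W(2d-1,q), Q(2d,q), H(2d,q), Q^-(2d+1,q) *)
Inductive polar_type := Qplus | Hodd | Wodd | Qeven | Heven | Qminus.

(* Vector space dimension, one more than the projective dimension. *)
Definition ambient_dim (t : polar_type) (d : nat) : nat :=
  match t with
  | Qplus | Hodd | Wodd => 2 * d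
  | Qeven | Heven => 2 * d + 1
  | Qminus => 2 * d + 2
  end.

Definition polar_param (R : realType) (t : polar_type) : R :=
  match t with
  | Qplus => 0
  | Hodd => 1 / 2
  | Wodd | Qeven => 1
  | Heven => 3 / 2
  | Qminus => 2
  end.

Definition has_form_type (F : finFieldType) n (P : polar_form F n)
    (t : polar_type) : bool :=
  match P, t with
  | OfQuadratic _, (Qplus | Qeven | Qminus) => true
  | OfHermitian _ _, (Hodd | Heven) => true
  | OfAlternating _, Wodd => true
  | _, _ => false
  end.

(* Together with the rank, the dimension separates Q^+, Q and Q^-. *)
Definition classical_polar_space (F : finFieldType) n (P : polar_form F n)
    (t : polar_type) (d : nat) : Prop :=
  [/\ nondegenerate_form P, has_form_type P t, n = ambient_dim t d
    & polar_rank P = d].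

Section Relations.
Variables (F : finFieldType) (n : nat) (P : polar_form F n).

(* Dimensions are integers so that the indices r - 1 = -1 and d - i + 1 = d + 1
   give the empty type, hence zero incidence maps. *)
Definition Omega (a : int) :=
  {U : {vspace 'rV[F]_n} | tot_isotropic P U && ((\dim U)%:Z == a)}.

Definition polar_rel (a b s k : int) (pa : Omega a) (pb : Omega b) : bool :=
  ((\dim (val pa :&: val pb)%VS)%:Z == s) &&
  ((\dim (val pa + (val pb :&: perp P (val pa)))%VS)%:Z == k).

Variable R : realType.

Definition Crel (a b s k : int) : 'M[R]_(#|{: Omega b}|, #|{: Omega a}|) :=
  \matrix_(i, j) (polar_rel s k (enum_val j) (enum_val i))%:R.

Definition Cinc (a b : int) := Crel a b (Num.min a b) (Num.max a b).

(* Elements of R^(Omega a) are represented by row vectors and subspaces by row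
   spaces, so the map x |-> C x becomes x |-> x *m C^T, whose image is the row
   space of C^T; eigenspaces of C are likewise [eigenspace C^T]. *)
Definition image_mx m p (C : 'M[R]_(m, p)) : 'M[R]_(p, m) := C^T.

(* Orthogonal complement for the standard inner product. *)
Definition orthc m p (A : 'M[R]_(m, p)) : 'M[R]_p := orthomx idfun 1%:M A.

Definition Vsp (d a r i : int) : 'M[R]_#|{: Omega a}| :=
  (image_mx (Cinc r a) :&: orthc (image_mx (Cinc (r - 1) a)) :&:
   image_mx (Cinc (d - i) a) :&: orthc (image_mx (Cinc (d - i + 1) a)))%MS.

End Relations.

Definition gauss_binom (R : realType) (q : R) (m k : nat) : R :=
  \prod_(j < k) ((q ^+ (m - j) - 1) / (q ^+ j.+1 - 1)).

(* Main.v *)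
(* Let U be the incidence operator from a-spaces to (a+1)-spaces, for all a at
   once, D its transpose and A the adjacency operator of the relation. Counting
   gives [UD - DU = A + c_a] on level a and [q A U = k_a U + U A]. Subtracting
   the claimed eigenvalue at every level turns A into an operator B with
   [q B U = U B]. A vector v of V_{r,i}^a is a lift from level r killed by
   D^(a-r+1), which yields [UD v = l_a v - b B v] with [b >= 0] and [l_a] an
   explicit scalar; dually v comes from level d-i and is killed by
   U^(d-i-a+1), which yields [DU v = l_(a+1) v + c B v] with [c >= 0]. The
   difference of the two relations is [(1 + b + c) B v = 0].
   The constants only require the number of singular vectors in the perp of a
   totally isotropic subspace, obtained from the cosets of a generator. *)
Require Import Defs.
From HB Require Import structures.
From mathcomp Require Import all_boot all_order all_algebra.
From mathcomp Require Import sesquilinear finfield.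
From mathcomp Require Import reals exp.
From mathcomp Require Import ring lra zify.
Import Order.TTheory GRing.Theory Num.Theory.
Local Open Scope ring_scope.
Set Implicit Arguments.
Unset Strict Implicit.
Unset Printing Implicit Defensive.

(** * Raising and lowering operators *)

(* Operators act on row vectors from the right: "first lower, then raise" is
   [U^T *m U], and [X] below is this product minus a scalar on each level. *)
Section UpDown.
Variables (R : realFieldType) (N : nat).

(** The method itself produces the eigenvalue formula. Asking that [B] commute with [U] up to the
    factor q fixes [mu] except for a multiple of q^(-a), and r and i enter the claimed formula only
    through that coefficient. The commutation of [U] with its transpose then fixes [lam] up to an
    additive constant. Both free constants are settled by requiring [lam] to vanish at the bottom
    level r and at d-i+1, one above the top level. Positivity is the other essential point. Each of
    the two relations for v alone leaves an unknown multiple of B v, and only the signs of b and c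
    exclude 1 + b + c = 0; hence their signs are tracked while their values are forgotten. All
    totally isotropic subspaces together index one square matrix, so powers of [U] need no
    bookkeeping of dimensions, and levels are seen only by diagonal matrices. No decomposition of
    R^Omega_a into the spaces V_{r,i}^a is used. *)

Lemma mulmx_trmx_eq0 m (u : 'M[R]_(m, N)) : u *m u^T = 0 -> u = 0.
Proof.
move=> u0; apply/matrixP => i j; rewrite mxE.
have /eqP := congr1 (fun M : 'M_m => M i i) u0; rewrite !mxE.
rewrite psumr_eq0; last by move=> k _; rewrite mxE -expr2 sqr_ge0.
by move/allP/(_ j (mem_index_enum _)); rewrite mxE mulf_eq0 orbb => /eqP.
Qed.

Lemma trmxX (U : 'M[R]_N) k : (U ^+ k)^T = U^T ^+ k.
Proof.
elim: k => [|k IHk]; first by rewrite !expr0 trmx1.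
by rewrite exprS exprSr -IHk [LHS]trmx_mul.
Qed.

Lemma mulX_trmx_eq0 m k (U : 'M[R]_N) (w : 'M[R]_(m, N)) :
  w *m U ^+ k *m U^T ^+ k = 0 -> w *m U ^+ k = 0.
Proof.
move=> w0; apply: mulmx_trmx_eq0.
by rewrite trmx_mul trmxX mulmxA w0 mul0mx.
Qed.

Variables (q : R) (U B X : 'M[R]_N).
Hypothesis q_gt0 : 0 < q.
Hypothesis BU : B *m U = q *: (U *m B).
Hypothesis UtB : U^T *m B = q *: (B *m U^T).
Hypothesis UX : U *m X = (X - B) *m U.
Hypothesis XUt : X *m U^T = U^T *m (X - B).

(** Every [U] that crosses [X] costs one copy of [B], and carrying these copies to the right end
    multiplies them by powers of q. Thus b = q + ... + q^k. *)
Lemma raising_powE k : exists2 b, 0 <= b &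
  U ^+ k *m X = X *m U ^+ k - b *: (U ^+ k *m B).
Proof.
have mulXS (A : 'M[R]_N) j : A ^+ j.+1 = A *m A ^+ j by rewrite exprS.
have BUk j : B *m U ^+ j = q ^+ j *: (U ^+ j *m B).
  elim: j => [|j IHj]; first by rewrite !expr0 mulmx1 mul1mx scale1r.
  by rewrite !mulXS exprS mulmxA BU -scalemxAl -!mulmxA IHj -scalemxAr scalerA.
elim: k => [|k [b b0 IHk]].
  by exists 0; rewrite // !expr0 mulmx1 mul1mx scale0r subr0.
exists (q ^+ k.+1 + b); first by rewrite addr_ge0 ?exprn_ge0 // ltW.
rewrite scalerDl -BUk mulXS -mulmxA IHk mulmxBr [U *m (X *m _)]mulmxA UX.
rewrite -scalemxAr.
by rewrite opprD addrA !mulmxA !mulmxBl.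
Qed.

(** Serves to show that the row vectors killed by [U^T ^+ k] are stable under [B] and [X]; explicit
    right factors stand in for an inclusion of kernels. *)
Lemma lowering_pow_kernel k : exists Z1 Z2,
  B *m U^T ^+ k = U^T ^+ k *m Z1 /\ X *m U^T ^+ k = U^T ^+ k *m Z2.
Proof.
have mulXS (A : 'M[R]_N) j : A ^+ j.+1 = A *m A ^+ j by rewrite exprS.
have BUt : B *m U^T = U^T *m (q^-1 *: B).
  by rewrite -scalemxAr UtB scalerA mulVf ?scale1r ?gt_eqF.
elim: k => [|k [Z1 [Z2 [e1 e2]]]].
  by exists B, X; rewrite !expr0 !mulmx1 !mul1mx.
exists (q^-1 *: Z1), (Z2 - Z1); rewrite !mulXS; split.
  by rewrite [LHS]mulmxA BUt -mulmxA -scalemxAl e1 -!scalemxAr mulmxA.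
by rewrite [LHS]mulmxA XUt -!mulmxA mulmxBl e1 e2 -mulmxBr.
Qed.

(* The defect [v X + b v B] of the conclusion is [w U^T U^(k+1)]; it lies both
   in the image of [U^(k+1)] and in the kernel of its transpose. *)
Lemma raising_eigen m k (w v : 'M[R]_(m, N)) :
    v = w *m U ^+ k -> w *m X = w *m U^T *m U -> v *m U^T ^+ k.+1 = 0 ->
  exists2 b, 0 <= b & v *m X = - b *: (v *m B).
Proof.
move=> vE wX vker; have [b b0 UkX] := raising_powE k.
have [Z1 [Z2 [e1 e2]]] := lowering_pow_kernel k.+1.
exists b => //; apply/eqP; rewrite scaleNr -addr_eq0; apply/eqP.
have yE : v *m X + b *: (v *m B) = w *m U^T *m U ^+ k.+1.
  rewrite exprS -[U * _]/(U *m _) mulmxA -wX vE -!mulmxA UkX.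
  by rewrite mulmxBr -scalemxAr subrK.
rewrite yE; apply: mulX_trmx_eq0; rewrite -yE mulmxDl -scalemxAl -!mulmxA e1 e2.
by rewrite !mulmxA vker !mul0mx scaler0 addr0.
Qed.
End UpDown.

(* The hypotheses of [raising_eigen] are symmetric under exchanging [U] with
   [U^T], [X] with [X - B], [B] with [- B] and [q] with [q^-1]. *)
Lemma up_down_eigen (R : realFieldType) N m (q : R) (U B X : 'M[R]_N)
    k l (w z v : 'M[R]_(m, N)) :
    0 < q -> B *m U = q *: (U *m B) -> U^T *m B = q *: (B *m U^T) ->
    U *m X = (X - B) *m U -> X *m U^T = U^T *m (X - B) ->
    v = w *m U ^+ k -> w *m X = w *m U^T *m U -> v *m U^T ^+ k.+1 = 0 ->
    v = z *m U^T ^+ l -> z *m (X - B) = z *m U *m U^T -> v *m U ^+ l.+1 = 0 ->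
  v *m B = 0.
Proof.
move=> q0 BU UtB UX XUt vw wX v0 vz zX v0'.
have [b b0 vX] := raising_eigen q0 BU UtB UX XUt vw wX v0.
have [||||||| |c c0 vY] :=
  @raising_eigen R N q^-1 U^T (- B) (X - B) _ _ _ _ _ m l z v.
- by rewrite invr_gt0.
- by rewrite mulNmx mulmxN UtB !scalerN scalerA mulVf ?scale1r ?gt_eqF.
- by rewrite trmxK mulNmx mulmxN BU !scalerN scalerA mulVf ?scale1r ?gt_eqF.
- by rewrite opprK subrK XUt.
- by rewrite trmxK opprK subrK UX.
- by [].
- by rewrite trmxK.
- by rewrite trmxK.
move: vY; rewrite mulmxBr vX mulmxN !scaleNr scalerN opprK => vY.
have : (1 + b + c) *: (v *m B) = 0.
  by rewrite 2!scalerDl scale1r -vY -opprD [b *: _ + _]addrC subrr.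
move/eqP; rewrite scaler_eq0 gt_eqF => [/eqP //|].
by rewrite -addrA ltr_wpDr ?addr_ge0 ?ltr01.
Qed.

(** * Forms and totally isotropic subspaces *)

Section Orthov.
Variables (F : fieldType) (eps : bool) (theta : {rmorphism F -> F}).
Variables (vT : vectType F) (f : {hermitian vT for eps & theta}).
Implicit Types U X : {vspace vT}.

Lemma leq_dim_cap_orthov X U :
  (\dim X <= \dim (X :&: orthov f U) + \dim U)%N.
Proof.
have span_bound (s : seq vT) :
    (\dim X <= \dim (X :&: orthov f <<s>>) + size s)%N.
  elim: s => [|u s IHs]; first by rewrite span_nil orthov0 capvf addn0.
  apply: leq_trans IHs _; rewrite /= addnS -addSn leq_add2r.
  have := leq_dim_orthov1 f u (X :&: orthov f <<s>>).
  rewrite -subn1 leq_subLR add1n => /leq_trans; apply; rewrite ltnS.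
  apply/dimvS/subvP => w; rewrite span_cons !memv_cap -andbA => /and3P[-> ws wu].
  apply/mem_orthovP => _ /memv_addP[u1 u1P [u2 u2P ->]].
  by rewrite linearDr /= (mem_orthovP wu) // (mem_orthovP ws) ?addr0.
by have := span_bound (vbasis U); rewrite (span_basis (vbasisP U)) size_tuple.
Qed.

(** A vector of U orthogonal to a complement of U^perp is orthogonal to the whole space, hence 0, so
    U is no larger than that complement. Only U has to miss the radical, because the polar form of a
    quadratic form may be degenerate in characteristic 2. *)
Lemma dim_orthov U : (U :&: orthov f fullv = 0)%VS ->
  (\dim U + \dim (orthov f U) = \dim {:vT})%N.
Proof.
move=> Urad; apply/eqP; rewrite eqn_leq; apply/andP; split; last first.
  by have := leq_dim_cap_orthov fullv U; rewrite capfv addnC.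
have := leq_dim_cap_orthov U (orthov f U)^C.
suff -> : (U :&: orthov f (orthov f U)^C = 0)%VS.
  by rewrite dimv0 add0n dimv_compl leq_subRL ?dimvS ?subvf // addnC.
apply/eqP; rewrite -subv0 -Urad; apply/subvP => u; rewrite !memv_cap.
move=> /andP[uU uC]; rewrite uU /=; apply/mem_orthovP => w _.
have : w \in fullv by rewrite memvf.
rewrite -(addv_complf (orthov f U)) => /memv_addP[w1 w1P [w2 w2P ->]].
rewrite linearDr /= (mem_orthovP uC w2) // addr0; apply/eqP.
by rewrite herm_eq0C (mem_orthovP w1P).
Qed.
End Orthov.

Section Forms.
Variables (F : finFieldType) (n : nat).
Notation V := 'rV[F]_n.
Implicit Types (P : polar_form F n) (u v w : V) (U W X : {vspace V}) (c : F).

Definition bform P : V -> V -> F :=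
  match P with
  | OfQuadratic Q => polar Q
  | OfHermitian _ f => f
  | OfAlternating f => f
  end.

Definition singular P v : bool :=
  match P with
  | OfQuadratic Q => Q v == 0
  | OfHermitian _ f => f v v == 0
  | OfAlternating _ => true
  end.

Lemma bformDr P u v w : bform P w (u + v) = bform P w u + bform P w v.
Proof. by case: P => [Q|theta f|f] /=; rewrite linearDr. Qed.

Lemma bformZl P c u w : bform P (c *: u) w = c * bform P u w.
Proof. by case: P => [Q|theta f|f] /=; rewrite linearZl_LR. Qed.

Lemma bform_eq0C P u v : (bform P u v == 0) = (bform P v u == 0).
Proof. by case: P => [Q|theta f|f] /=; rewrite herm_eq0C. Qed.

Lemma mem_perpP P U u :
  reflect {in U, forall v, bform P u v = 0} (u \in perp P U).
Proof. by case: P => [Q|theta f|f]; apply: mem_orthovP. Qed.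

Lemma perp_sym P U W : (U <= perp P W)%VS = (W <= perp P U)%VS.
Proof. by case: P => [Q|theta f|f]; apply: orthov_sym. Qed.

Lemma leq_dim_cap_perp P X U :
  (\dim X <= \dim (X :&: perp P U) + \dim U)%N.
Proof. by case: P => [Q|theta f|f]; apply: leq_dim_cap_orthov. Qed.

Lemma quad0 (Q : quadratic_form F n) : Q 0 = 0.
Proof. by rewrite -(scale0r (0 : V)) quadZ expr0n mul0r. Qed.

Lemma singularZ P c u : singular P u -> singular P (c *: u).
Proof.
case: P => [Q|theta f|f] //= /eqP e; first by rewrite quadZ e mulr0.
by rewrite linearZl_LR linearZr_LR /= e !mulr0.
Qed.

Lemma singularD P u v : bform P u v = 0 -> singular P u ->
  singular P (u + v) = singular P v.
Proof.
case: P => [Q|theta f|f] //= uv /eqP e; first by rewrite quadD uv e add0r addr0.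
have vu : f v u = 0 by apply/eqP; rewrite herm_eq0C uv.
by rewrite linearDl !linearDr /= e uv vu !add0r.
Qed.

(** Puts the three kinds of form on one footing. For a quadratic form, orthogonality is the
    polarisation of Q = 0 on U; for a Hermitian form, singularity is the diagonal case of
    orthogonality. *)
Lemma tot_isotropicP P U : nondegenerate_form P ->
  reflect ({in U, forall u, singular P u} /\ (U <= perp P U)%VS)
    (tot_isotropic P U).
Proof.
case: P => [Q|theta f|f] /= nd.
- apply: (iffP forallP) => [QU|[QU _] u]; last by apply/implyP/QU.
  have Q0 : {in U, forall u, Q u = 0}.
    by move=> u uU; apply/eqP/(implyP (QU u)).
  split=> [u /Q0 ->|]; first exact: eqxx.
  apply/orthovP => u v uU vU; have := Q0 _ (memvD uU vU).
  by rewrite quadD !Q0 // !add0r.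
- apply: (iffP idP) => [UU|[] //]; split=> // u uU.
  by rewrite (orthovP UU).
- by apply: (iffP idP) => [UU|[] //]; split.
Qed.

End Forms.

(** * Trace and fixed field of a field involution *)

Section Involution.
Variables (F : finFieldType) (theta : involutive_rmorphism F).
Hypothesis theta_neq_id : ~ (theta =1 id).

Let fixed := [set x | theta x == x].

(* For [theta u != u], both [(a, b) |-> a + b u] from [fixed^2] to [F] and
   [x |-> (x + theta x, u x + theta (u x))] back are injective. *)
Lemma involution_trace :
  (#|fixed| * #|fixed| = #|F|)%N /\
  forall c, theta c = c -> #|[set x | x + theta x == c]| = #|fixed|.
Proof.
have [u thu] : exists u, theta u != u.
  apply/existsP; apply: contra_notT theta_neq_id; rewrite negb_exists.
  by move=> /forallP all_id x; apply/eqP; rewrite -[_ == _]negbK.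
pose t x := x + theta x; pose h x := (t x, t (u * x)).
have t_fixed x : t x \in fixed.
  by rewrite inE rmorphD /= rmorphK addrC.
have tB x y : t (x - y) = t x - t y by rewrite /t rmorphB /= opprD addrACA.
have h_inj : injective h.
  move=> x y [txy tuxy]; apply/eqP; rewrite -subr_eq0; set z := x - y.
  have tz : t z = 0 by rewrite tB txy subrr.
  have tuz : t (u * z) = 0 by rewrite mulrBr tB tuxy subrr.
  have thz : theta z = - z by apply/eqP; rewrite -addr_eq0 addrC -/(t z) tz.
  move/eqP: tuz; rewrite /t rmorphM /= thz mulrN -mulrBl mulf_eq0 subr_eq0.
  by rewrite eq_sym (negPf thu).
have h_sub : h @: [set: F] \subset setX fixed fixed.
  by apply/subsetP => _ /imsetP[x _ ->]; rewrite in_setX !t_fixed.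
have g_inj : {in setX fixed fixed &, injective (fun p : F * F => p.1 + p.2 * u)}.
  move=> [a b] [a' b'] /=; rewrite !in_setX /= !inE.
  move=> /andP[/eqP tha /eqP thb] /andP[/eqP tha' /eqP thb'] e.
  have e1 : (b - b') * u = a' - a.
    have -> : (b - b') * u = (a + b * u) - (a + b' * u) by ring.
    by rewrite e; ring.
  have e2 : (b - b') * theta u = a' - a.
    by rewrite -{1}thb -{1}thb' -rmorphB -rmorphM e1 rmorphB /= tha tha'.
  have : (b - b') * (theta u - u) = 0 by rewrite mulrBr e1 e2 subrr.
  move/eqP; rewrite mulf_eq0 !subr_eq0 (negPf thu) orbF => /eqP bb'.
  by move: e; rewrite bb' => /addIr ->.
have sq : (#|fixed| * #|fixed| = #|F|)%N.
  apply/eqP; rewrite -cardsX eqn_leq -{1}(card_in_imset g_inj) max_card /=.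
  by rewrite -cardsT -(card_imset _ h_inj) subset_leq_card.
have h_im : h @: [set: F] = setX fixed fixed.
  by apply/eqP; rewrite eqEcard h_sub card_imset // cardsT cardsX sq /=.
(* By cardinality [h] maps onto [fixed^2], and its first coordinate is the trace, so the fibre over
   c corresponds to {c} x [fixed]. *)
split=> // c thc; rewrite -(card_imset _ h_inj).
have -> : h @: [set x | x + theta x == c] = setX [set c] fixed.
  apply/setP => -[a b]; rewrite in_setX inE; apply/imsetP/andP => /=.
    by move=> [x]; rewrite inE => /eqP <- [-> ->].
  move=> [/eqP -> bf]; have : (c, b) \in setX fixed fixed.
    by rewrite in_setX bf inE thc eqxx.
  by rewrite -h_im => /imsetP[x _ e]; exists x => //; case: e => -> _; rewrite inE.
by rewrite cardsX cards1 mul1n.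
Qed.
End Involution.

Section Counting.
Variables (F : finFieldType) (n : nat).
Notation V := 'rV[F]_n.
Implicit Types (P : polar_form F n) (u v w : V) (U W X G : {vspace V}) (c : F).

Lemma card_subspace U : #|[set v | v \in U]| = (#|F| ^ \dim U)%N.
Proof. by rewrite cardsE card_vspace. Qed.

(** A nonzero semilinear functional takes every value on G, so its fibres are translates of one
    another and share G evenly. Here [sigma] will be the identity for a polar form and [theta] for a
    Hermitian form. *)
Lemma card_semilinear_fiber G (phi : V -> F) (sigma : F -> F) :
    {morph phi : u v / u + v} -> (forall c v, phi (c *: v) = sigma c * phi v) ->
    (forall y, exists c, sigma c = y) -> (exists2 g, g \in G & phi g != 0) ->
  forall y, (#|[set g in G | phi g == y]| * #|F| = #|F| ^ \dim G)%N.
Proof.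
move=> phiD phiZ sigma_surj [g0 g0G g0_neq0] y.
have translate z : #|[set g in G | phi g == z]| = #|[set g in G | phi g == y]|.
  have [c cE] := sigma_surj ((z - y) / phi g0).
  have [h hG hE] : exists2 h, h \in G & phi h = z - y.
    by exists (c *: g0); rewrite ?memvZ // phiZ cE divfK.
  rewrite -[RHS](card_imset _ (addIr h)); apply: eq_card => g.
  apply/idP/imsetP => [|[g' + ->]]; rewrite !inE.
    move=> /andP[gG /eqP gz]; exists (g - h); rewrite ?subrK // inE memvB //=.
    have : phi (g - h + h) = z by rewrite subrK.
    by rewrite phiD hE addrCA -[RHS]addr0 => /addrI /eqP; rewrite subr_eq0.
  by move=> /andP[g'G /eqP e]; rewrite memvD //= phiD e hE addrC subrK.
rewrite -card_subspace mulnC -sum_nat_const.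
under eq_bigr => z _ do rewrite -(translate z).
rewrite -[RHS]sum1_card (partition_big phi predT) //=.
apply: eq_bigr => z _; rewrite -sum1_card; apply: eq_bigl => g.
by rewrite !inE.
Qed.

(* The singular vectors make up a fraction [1 / coset_ratio P] of every coset of
   a totally isotropic [G] not contained in [G^perp]; the Hermitian value is
   [sqrt q]. *)
Definition coset_ratio P : nat :=
  match P with
  | OfQuadratic _ => #|F|
  | OfHermitian theta _ => #|[set x | theta x == x]|
  | OfAlternating _ => 1
  end.

Lemma coset_ratio_gt0 P : (0 < coset_ratio P)%N.
Proof.
case: P => [Q|theta f|f] //=; first by rewrite (cardD1 0).
by rewrite (cardsD1 0) inE rmorph0 eqxx.
Qed.

(** Since the vectors of G are singular, singularity of v + g depends on f(v,g) alone: this value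
    must be -Q(v) in the quadratic case, must have trace -f(v,v) in the Hermitian case, and is free
    in the alternating case. Each admissible value has an equally large fibre in G. *)
Lemma card_singular_coset P G v : nondegenerate_form P ->
    tot_isotropic P G -> v \notin perp P G ->
  (#|[set g in G | singular P (v + g)]| * coset_ratio P = #|F| ^ \dim G)%N.
Proof.
move=> nd Gti vG; have [Gsing Gperp] := tot_isotropicP _ nd Gti.
have [g0 g0G g0v] : exists2 g, g \in G & bform P v g != 0.
  by case: (P) vG => [Q|theta f|f] /mem_orthovPn.
case: P nd Gti vG Gsing Gperp g0v => [Q|theta f|f] /= nd Gti vG Gsing Gperp g0v.
- have fib := @card_semilinear_fiber G (polar Q v) id _ _ _ _ (- Q v).
  rewrite -fib; first last.
  + by exists g0.
  + by move=> y; exists y.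
  + by move=> c w; rewrite linearZ_LR.
  + by move=> u w; rewrite linearDr.
  congr (_ * _)%N; apply: eq_card => g; rewrite !inE.
  have [gG|//] := boolP (g \in G).
  by rewrite quadD (eqP (Gsing g gG)) addr0 /= addrC addr_eq0.
- have [_ /involution_trace[card_fix card_tr]] := nd.
  have vv : theta (f v v) = f v v by rewrite {2}[f v v]hermC expr0 mul1r.
  have fib x : (#|[set g in G | f v g == x]| * #|F| = #|F| ^ \dim G)%N.
    apply: (@card_semilinear_fiber G (f v) theta) => [u w|c w|y|].
    + by rewrite linearDr.
    + by rewrite linearZr_LR.
    + by exists (theta y); rewrite rmorphK.
    + by exists g0.
  have sing_vg g : g \in G ->
      (f (v + g) (v + g) == 0) = (f v g + theta (f v g) == - f v v).
    move=> gG; rewrite linearDl !linearDr /= (eqP (Gsing g gG)) addr0.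
    by rewrite [f g v]hermC expr0 mul1r -addrA addrC addr_eq0.
  rewrite -sum1_card (partition_big (f v) (fun x => x + theta x == - f v v));
    last first.
    by move=> g; rewrite inE => /andP[gG]; rewrite sing_vg.
  rewrite (eq_bigr (fun=> #|[set g in G | f v g == 0]|)) => [|x xP]; last first.
    have F_gt0 : (0 < #|F|)%N by rewrite (cardD1 0).
    apply/eqP; rewrite -(eqn_pmul2r F_gt0) fib -(fib x) eqn_pmul2r //; apply/eqP.
    rewrite -sum1_card; apply: eq_bigl => g; rewrite !inE.
    have [gG|//] := boolP (g \in G); rewrite /= sing_vg //.
    by have [->|] := eqVneq (f v g) x; rewrite ?xP ?andbF ?andbT.
  rewrite sum_nat_const -cardsE card_tr; last by rewrite rmorphN /= vv.
  rewrite mulnAC card_fix mulnC.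
  exact: fib.
- rewrite muln1 -card_subspace; apply: eq_card => g.
  by rewrite !inE andbT.
Qed.

End Counting.

(** * Totally isotropic subspaces and their perps *)

Section Isotropic.
Variables (F : finFieldType) (n : nat) (P : polar_form F n).
Hypothesis ndP : nondegenerate_form P.
Notation V := 'rV[F]_n.
Notation ti := (tot_isotropic P).
Notation B := (bform P).
Implicit Types (u v w : V) (U W X G : {vspace V}) (c : F).

Lemma singular_isotropic v : singular P v -> B v v = 0.
Proof.
case: P ndP => [Q|theta f|f] /= nd; last 1 first.
(* Skew symmetry gives only 2 f(v,v) = 0; in characteristic 2 the last clause of [is_psymplectic]
   supplies f(v,v) = 0. *)
- case: nd => _ _ nd2 _; have [/nd2 -> //|char2] := boolP (2 \in [pchar F]).
  have : f v v *+ 2 = 0 by rewrite mulr2n {1}[f v v]hermC expr1 mulN1r addNr.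
  move/eqP; rewrite -mulr_natr mulf_eq0 => /orP[/eqP //|].
  by move: char2; rewrite inE /= => /negPf ->.
- move/eqP => Qv; have := quadD Q v v; rewrite Qv !add0r => <-.
  by rewrite -mulr2n -scaler_nat quadZ Qv mulr0.
- by move/eqP.
Qed.

Lemma ti_line v : singular P v -> ti <[v]>.
Proof.
move=> sv; apply/tot_isotropicP => //; split.
  by move=> _ /vlineP[c ->]; apply: singularZ.
apply/subvP => _ /vlineP[c ->]; apply/mem_perpP => _ /vlineP[c' ->].
rewrite bformZl; apply/eqP; rewrite mulf_eq0 bform_eq0C bformZl mulf_eq0.
by rewrite singular_isotropic ?eqxx ?orbT.
Qed.

Lemma ti_singular U u : ti U -> u \in U -> singular P u.
Proof. by move=> /(tot_isotropicP _ ndP)[sU _] /sU. Qed.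

Lemma ti_perp U : ti U -> (U <= perp P U)%VS.
Proof. by move=> /(tot_isotropicP _ ndP)[]. Qed.

Lemma perpS U W : (U <= W)%VS -> (perp P W <= perp P U)%VS.
Proof.
move=> /subvP UW; apply/subvP => u /mem_perpP uW; apply/mem_perpP => v /UW.
exact: uW.
Qed.

Lemma ti_sub U W : (U <= W)%VS -> ti W -> ti U.
Proof.
move=> UW tiW; apply/tot_isotropicP => //; split.
  by move=> u uU; apply: (ti_singular tiW); apply: (subvP UW).
exact: subv_trans UW (subv_trans (ti_perp tiW) (perpS UW)).
Qed.

Lemma mem_perpD U W u : (u \in perp P (U + W)) = (u \in perp P U) && (u \in perp P W).
Proof.
apply/idP/andP => [uUW|[/mem_perpP uU /mem_perpP uW]].
  by split; apply: subvP uUW; rewrite perpS ?addvSl ?addvSr.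
apply/mem_perpP => _ /memv_addP[x xU [y yW ->]].
by rewrite bformDr uU // uW // addr0.
Qed.

Lemma tiD U W : ti (U + W) = [&& ti U, ti W & (W <= perp P U)%VS].
Proof.
apply/idP/and3P => [tiUW|[tiU tiW WU]].
  split; rewrite ?(ti_sub _ tiUW) ?addvSl ?addvSr //.
  apply: subv_trans (addvSr U W) (subv_trans (ti_perp tiUW) _).
  by rewrite perpS ?addvSl.
apply/tot_isotropicP => //; split.
  move=> _ /memv_addP[x xU [y yW ->]].
  rewrite singularD; [exact: ti_singular tiW yW| |exact: ti_singular tiU xU].
  have /mem_perpP yU := subvP WU y yW.
  by apply/eqP; rewrite bform_eq0C yU.
have UWU : (U + W <= perp P U)%VS by rewrite subv_add ti_perp.
have UWW : (U + W <= perp P W)%VS by rewrite subv_add ti_perp // perp_sym WU.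
by apply/subvP => u uUW; rewrite mem_perpD (subvP UWU) ?(subvP UWW).
Qed.

Lemma dim_perp U : ti U -> (\dim U + \dim (perp P U) = n)%N.
Proof.
move=> tiU; have nE : \dim {:V} = n by rewrite dimvf dim_matrix; apply: mul1n.
rewrite -[RHS]nE.
have Urad : (U :&: perp P fullv)%VS = 0%VS.
  apply/eqP; rewrite -subv0; apply/subvP => u /memv_capP[uU urad].
  rewrite memv0; have := ti_singular tiU uU.
  case: P ndP urad => [Q|theta f|f] /= nd urad Qu; first by rewrite (nd u) ?(eqP Qu).
    by case: nd => [[/eqP nd _] _]; rewrite nd memv0 in urad.
  by case: nd => [/eqP nd _ _]; rewrite nd memv0 in urad.
by case: P Urad => [Q|theta f|f] /= Urad; apply: dim_orthov.
Qed.

(** The part of X inside W imposes no condition on W, as W is isotropic; only a complement of it in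
    X does. *)
Lemma leq_dim_ti_cap_perp X W : ti W ->
  (\dim W + \dim (X :&: W) <= \dim (W :&: perp P X) + \dim X)%N.
Proof.
move=> tiW; have := leq_dim_cap_perp P W (X :\: W).
rewrite -(leq_add2r (\dim (X :&: W))) -addnA [X in (_ <= _ + X)%N]addnC.
rewrite dimv_cap_compl => /leq_trans; apply; rewrite leq_add2r.
apply/dimvS/subvP => w /memv_capP[wW wXW].
rewrite memv_cap wW -[X in perp P X](addv_diff_cap X W) mem_perpD wXW /=.
exact: subvP (subv_trans (ti_perp tiW) (perpS (capvSr _ _))) _ wW.
Qed.

Lemma leq_dim_rank U : ti U -> (\dim U <= polar_rank P)%N.
Proof. exact: leq_bigmax_cond. Qed.

Lemma ti0 : ti 0%VS.
Proof.
apply/tot_isotropicP => //; split; last by rewrite sub0v.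
by move=> u; rewrite memv0 => /eqP ->; rewrite -(scale0r (0 : V)) singularZ //;
  case: (P) => [Q|theta f|f] //=; rewrite ?quad0 ?linear0l.
Qed.
End Isotropic.

(** * Generators and the number of singular vectors in a perp *)

Section SingularCount.
Variables (F : finFieldType) (n : nat) (P : polar_form F n) (d : nat).
Hypotheses (ndP : nondegenerate_form P) (rankP : polar_rank P = d).
Notation V := 'rV[F]_n.
Notation ti := (tot_isotropic P).
Notation q := #|F|.
Implicit Types (u v w : V) (U W X G : {vspace V}) (c : F).

(* If [M] has maximal dimension then [U + (M :&: U^perp)] already has
   dimension at least [d]. *)
Lemma exists_generator U : ti U -> exists G, [/\ ti G, (U <= G)%VS & \dim G = d].
Proof.
move=> tiU; have [M tiM dimM] : exists2 M, ti M & \dim M = d.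
  have [M tiM] := eq_bigmax_cond (fun W : {vspace V} => \dim W)
    (introT card_gt0P (ex_intro _ 0%VS (ti0 ndP))).
  by rewrite -rankP => dimM; exists M.
have tiG : ti (U + (M :&: perp P U)).
  by rewrite tiD // tiU (ti_sub ndP (capvSl _ _)) // capvSr.
exists (U + (M :&: perp P U))%VS; split; rewrite ?addvSl //.
apply/eqP; rewrite eqn_leq -{1}rankP leq_dim_rank //=.
have := dimv_sum_cap U (M :&: perp P U).
have := leq_dim_ti_cap_perp ndP U tiM; rewrite dimM.
have : (\dim (U :&: (M :&: perp P U)) <= \dim (U :&: M))%N.
  by rewrite dimvS // capvS // capvSl.
lia.
Qed.

Lemma singular_perp_generator G v : ti G -> \dim G = d ->
  (v \in perp P G) && singular P v = (v \in G).
Proof.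
move=> tiG dimG; apply/andP/idP => [[vG sv]|vG]; last first.
  by rewrite (ti_singular ndP tiG) // (subvP (ti_perp ndP tiG)).
have tiGv : ti (G + <[v]>) by rewrite tiD // tiG ti_line //= -memvE.
have : (G == G + <[v]>)%VS by rewrite eqEdim addvSl dimG -rankP leq_dim_rank.
by move/eqP => ->; rewrite (subvP (addvSr _ _)) ?memv_line.
Qed.

(* Split the perp of [U] along the perp of a generator [G >= U]: inside it only
   the vectors of [G] are singular, outside it [card_singular_coset] applies. *)
Lemma card_singular_perp U : ti U ->
  (#|[set v in perp P U | singular P v]| * coset_ratio P + q ^ (n - d) =
   coset_ratio P * q ^ d + q ^ (n - \dim U))%N.
Proof.
move=> tiU; have [G [tiG UG dimG]] := exists_generator tiU.
have GU := perpS P UG.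
have dimpU : (n - \dim U = \dim (perp P U))%N by have := dim_perp ndP tiU; lia.
have dimpG : (n - d = \dim (perp P G))%N by have := dim_perp ndP tiG; lia.
rewrite dimpU dimpG -!card_subspace.
pose D := [set v in perp P U | v \notin perp P G].
pose S := [set v in D | singular P v].
have cardD : (#|D| + #|[set v in perp P G]| = #|[set v in perp P U]|)%N.
  rewrite addnC -(cardsID [set v in perp P G] [set v in perp P U]).
  by congr (_ + _)%N; apply: eq_card => v; rewrite !inE; have := subvP GU v;
    case: (v \in perp P G); case: (v \in perp P U) => //= ->.
have cardS : (#|[set v in perp P U | singular P v]| = q ^ d + #|S|)%N.
  rewrite -(cardsID [set v in perp P G]) -dimG -card_subspace.
  congr (_ + _)%N; apply: eq_card => v; rewrite !inE.
    rewrite -(singular_perp_generator v tiG dimG) andbC andbA; congr (_ && _).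
    by have := subvP GU v; case: (_ \in perp P G) => //= ->.
  by rewrite andbC -!andbA; congr (_ && _); rewrite andbC.
suff SD : (#|S| * coset_ratio P = #|D|)%N.
  by rewrite cardS mulnDl SD -addnA cardD mulnC.
(* [D] is a union of cosets of G. Summing over all translations by G replaces a choice of coset
   representatives. *)
have translate g : g \in G -> #|S| = (\sum_(v in D) singular P (v + g))%N.
  move=> gG; have Dg v : (v + g \in D) = (v \in D).
    have gpG := subvP (ti_perp ndP tiG) _ gG.
    by rewrite !inE !rpredDr // (subvP GU).
  rewrite -sum1_card (reindex_inj (addIr g)) big_mkcond [RHS]big_mkcond /=.
  by apply: eq_bigr => v _; rewrite inE Dg; case: (v \in D).
have : (#|G| * #|S| = \sum_(v in D) \sum_(g in G) singular P (v + g))%N.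
  rewrite exchange_big -sum_nat_const; apply: eq_bigr => g gG.
  exact: translate.
move/(congr1 (muln^~ (coset_ratio P))); rewrite -mulnA big_distrl /=.
rewrite (eq_bigr (fun=> q ^ \dim G)%N) => [|v]; last first.
  rewrite !inE => /andP[_ vG]; rewrite -(card_singular_coset ndP tiG vG).
  congr (_ * _)%N; rewrite -sum1_card big_mkcond [RHS]big_mkcond /=.
  by apply: eq_bigr => g _; rewrite !inE; case: (g \in G); case: singular.
rewrite sum_nat_const [RHS]mulnC card_vspace => /eqP.
by rewrite eqn_pmul2l ?expn_gt0 ?(ltnW (finNzRing_gt1 F)) // => /eqP.
Qed.
End SingularCount.

(** * Counting subspaces *)

Section SubspaceCount.
Variables (F : finFieldType) (n : nat).
Notation V := 'rV[F]_n.
Notation q := #|F|.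
Implicit Types (u v w : V) (s t U W X H : {vspace V}).

Lemma dim_add_line s v : v \notin s -> \dim (s + <[v]>) = (\dim s).+1.
Proof.
move=> vs; have := dimv_sum_cap s <[v]>; rewrite dim_vline.
have -> : v != 0 by apply: contraNneq vs => ->; rewrite mem0v.
suff -> : (s :&: <[v]> = 0)%VS by rewrite dimv0 addn0 addn1.
apply/eqP; rewrite -subv0; apply/subvP => w /memv_capP[ws /vlineP[c e]].
move: ws; rewrite e memv0; have [->|c0] := eqVneq c 0; first by rewrite scale0r.
by rewrite rpredZeq (negPf c0) (negPf vs).
Qed.

(** The vectors v with s + <v> = X are those of X outside s, equally many for every X. Leaving [p]
    arbitrary lets one count serve for containment, isotropy and non-orthogonality. *)
Lemma card_covers s (p : pred {vspace V}) :
  (#|[set X | [&& (s <= X)%VS, \dim X == (\dim s).+1 & p X]]|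
     * (q ^ (\dim s).+1 - q ^ \dim s) =
   #|[set v | (v \notin s) && p (s + <[v]>)%VS]|)%N.
Proof.
rewrite -[RHS]sum1_card.
rewrite (partition_big (fun v => s + <[v]>)%VS
  (mem [set X | [&& (s <= X)%VS, \dim X == (\dim s).+1 & p X]])) /=; last first.
  by move=> v; rewrite !inE => /andP[vs ->]; rewrite addvSl dim_add_line // eqxx.
rewrite -sum_nat_const; apply: eq_bigr => X; rewrite inE => /and3P[sX /eqP dX pX].
rewrite -dX -!card_subspace.
have -> : (#|[set v in X]| - #|[set v in s]| = #|[set v in X] :\: [set v in s]|)%N.
  rewrite cardsD (setIidPr _) //; apply/subsetP => v; rewrite !inE.
  exact: subvP.
rewrite -sum1_card; apply: eq_bigl => v; rewrite !inE.
apply/andP/andP => [[vs vX]|[/andP[vs _] /eqP <-]].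
  suff /eqP e : (s + <[v]> == X)%VS by rewrite vs e pX eqxx.
  by rewrite eqEdim dim_add_line // dX leqnn andbT subv_add sX -memvE.
by rewrite vs (subvP (addvSr _ _)) ?memv_line.
Qed.

Lemma card_covers_below s U : (s <= U)%VS ->
  (#|[set X | [&& (s <= X)%VS, \dim X == (\dim s).+1 & (X <= U)%VS]]| * (q - 1) =
   q ^ (\dim U - \dim s) - 1)%N.
Proof.
move=> sU; have := card_covers s (fun X => X <= U)%VS.
have -> : #|[set v | (v \notin s) && (s + <[v]> <= U)%VS]| =
    (q ^ \dim U - q ^ \dim s)%N.
  rewrite -!card_subspace.
  have -> : (#|[set v in U]| - #|[set v in s]| = #|[set v in U] :\: [set v in s]|)%N.
    rewrite cardsD (setIidPr _) //; apply/subsetP => v; rewrite !inE.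
    exact: subvP.
  by apply: eq_card => v; rewrite !inE subv_add sU -memvE.
have q0 : (0 < q ^ \dim s)%N by rewrite expn_gt0 (ltnW (finNzRing_gt1 F)).
have -> : (q ^ \dim U = q ^ (\dim U - \dim s) * q ^ \dim s)%N.
  by rewrite -expnD subnK // dimvS.
rewrite expnS -{2 4}[(q ^ \dim s)%N]mul1n -!mulnBl mulnA => /eqP.
by rewrite eqn_pmul2r // => /eqP.
Qed.

(* Flags [s <= t <= H <= U] are counted from [t] and from [H]. *)
Lemma card_hyperplanes s U : (s <= U)%VS ->
  (#|[set H | [&& (s <= H)%VS, (H <= U)%VS & (\dim H).+1 == \dim U]]| * (q - 1) =
   q ^ (\dim U - \dim s) - 1)%N.
Proof.
have q10 : (0 < q - 1)%N by rewrite subn_gt0 finNzRing_gt1.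
have [c cE] : exists c, (\dim U - \dim s = c)%N by exists (\dim U - \dim s)%N.
elim: c s cE => [|c IHc] s cE sU; rewrite cE.
  rewrite expn0 subnn (_ : [set H | _] = set0) ?cards0 //.
  apply/setP => H; rewrite !inE; apply/negP => /and3P[/dimvS sH /dimvS HU /eqP].
  by have := dimvS sU; lia.
(* Codimension one is treated apart: the double count ends by cancelling q^c - 1, which is 0
   there. *)
have [c0|c_gt0] := posnP c.
  rewrite (_ : [set H | _] = [set s]) ?cards1 ?c0 ?mul1n //.
  have dU : \dim U = (\dim s).+1 by have := dimvS sU; lia.
  apply/setP => H; rewrite !inE dU eqSS; apply/and3P/eqP => [[sH HU /eqP dH]|->].
    by apply/eqP; rewrite eq_sym eqEdim sH dH leqnn.
  by rewrite subvv eqxx.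
set h := #|_|.
set T := [set X | [&& (s <= X)%VS, \dim X == (\dim s).+1 & (X <= U)%VS]].
have hT := card_covers_below sU; rewrite cE -/T in hT.
have q_pow : (0 < q ^ c - 1)%N by rewrite subn_gt0 -(expn0 q) ltn_exp2l ?finNzRing_gt1.
suff : (h * (q ^ c - 1) = #|T| * (q ^ c - 1))%N.
  by move/eqP; rewrite eqn_pmul2r // => /eqP ->.
transitivity (\sum_(H in [set H |
      [&& (s <= H)%VS, (H <= U)%VS & (\dim H).+1 == \dim U]])
    \sum_(X in T | (X <= H)%VS) (q - 1))%N.
  rewrite -sum_nat_const; apply: eq_bigr => H; rewrite inE => /and3P[sH HU /eqP dH].
  have -> : (c = \dim H - \dim s)%N by lia.
  rewrite -(card_covers_below sH) -sum_nat_const; apply: eq_bigl => X.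
  rewrite !inE; case XH: (X <= H)%VS; rewrite ?andbF ?andbT //.
  by rewrite (subv_trans XH HU) !andbT.
rewrite (exchange_big_dep (mem T)) /=; last by move=> H X _ /andP[].
rewrite -sum_nat_const; apply: eq_bigr => X.
rewrite inE => /and3P[sX /eqP dX XU].
have cX : (\dim U - \dim X = c)%N by lia.
rewrite -[in RHS]cX -(IHc X cX XU).
rewrite -sum_nat_const; apply: eq_bigl => H.
rewrite !inE sX dX eqxx XU /=; case XH: (X <= H)%VS; rewrite ?andbF //=.
by rewrite (subv_trans sX XH) andbT.
Qed.
End SubspaceCount.

(** * Two-step paths made of covers and of the relation *)

Section PolarCovers.
Variables (F : finFieldType) (n : nat) (P : polar_form F n).
Hypothesis ndP : nondegenerate_form P.
Notation V := 'rV[F]_n.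
Notation q := #|F|.
Notation ti := (tot_isotropic P).
Implicit Types (u v w : V) (s U W X x y z : {vspace V}).

Lemma ti_add_line s v : v \notin s -> ti s ->
  ti (s + <[v]>)%VS = (v \in perp P s) && singular P v.
Proof.
move=> vs tis; rewrite tiD // tis -memvE /= andbC; congr (_ && _).
apply/idP/idP => [tiv|]; last exact: (ti_line ndP).
by rewrite (ti_singular ndP tiv) ?memv_line.
Qed.

Lemma card_ti_covers s : ti s ->
  (#|[set X | [&& (s <= X)%VS, \dim X == (\dim s).+1 & ti X]]|
     * (q ^ (\dim s).+1 - q ^ \dim s) + q ^ \dim s =
   #|[set v in perp P s | singular P v]|)%N.
Proof.
move=> tis; rewrite card_covers -[RHS](cardsID [set v in s]) addnC.
rewrite -card_subspace.
congr (_ + _)%N; apply: eq_card => v; rewrite !inE.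
  apply/idP/andP => [vs|[]//]; rewrite vs (ti_singular ndP tis) //.
  by rewrite (subvP (ti_perp ndP tis)).
by case: (boolP (v \in s)) => // vs; rewrite ti_add_line.
Qed.

(** Writing X = s + <v>, the cover X lies in U^perp exactly when v does, so two counts of singular
    vectors are subtracted. For s a hyperplane of U this is the constant governing how [mu] changes
    by one level. *)
Lemma card_opposite_covers s U : ti U -> (s <= U)%VS ->
  (#|[set X | [&& (s <= X)%VS, \dim X == (\dim s).+1 &
                  ti X && ~~ (X <= perp P U)%VS]]|
     * (q ^ (\dim s).+1 - q ^ \dim s) + #|[set v in perp P U | singular P v]| =
   #|[set v in perp P s | singular P v]|)%N.
Proof.
move=> tiU sU; have tis := ti_sub ndP sU tiU; rewrite card_covers.
have sU' : (s <= perp P U)%VS := subv_trans sU (ti_perp ndP tiU).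
rewrite -(cardsID [set v in perp P U] [set v in perp P s | _]) addnC.
congr (_ + _)%N; apply: eq_card => v; rewrite !inE.
  rewrite -andbA [_ && (v \in perp P U)]andbC.
  by case: (boolP (v \in perp P U)) => [/(subvP (perpS P sU)) ->|]; rewrite ?andbF.
have [vs|vs] := boolP (v \in s); first by rewrite (subvP sU').
by rewrite ti_add_line // subv_add sU' -memvE [RHS]andbC.
Qed.

(** The relation R_{a,a}^{a-1,a} for all a at once, in a form symmetric in x and y;
    [polar_rel_opposite] gives the agreement. *)
Definition opposite_adj x y :=
  [&& \dim x == \dim y, (\dim (x :&: y)).+1 == \dim x & ~~ (y <= perp P x)%VS].

Lemma opposite_adjC x y : opposite_adj x y = opposite_adj y x.
Proof.
rewrite /opposite_adj [(_ :&: _)%VS]capvC [(_ <= _)%VS]perp_sym eq_sym.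
by case: eqP => //= ->.
Qed.

Lemma opposite_adj_cover_sub x y : ti y -> (x <= y)%VS ->
  [set z | [&& (z <= y)%VS, (\dim z).+1 == \dim y, ti z & opposite_adj x z]] = set0.
Proof.
move=> tiy xy; apply/setP => z; rewrite !inE; apply/negP => /and4P[zy _ _ /and3P[_ _]].
by rewrite (subv_trans zy (subv_trans (ti_perp ndP tiy) (perpS P xy))).
Qed.

Lemma opposite_adj_sub_cover x y : (x <= y)%VS -> \dim y = (\dim x).+1 ->
  [set z | [&& (x <= z)%VS, \dim z == (\dim x).+1, ti z & opposite_adj z y]] =
  [set z | [&& (x <= z)%VS, \dim z == (\dim x).+1 & ti z && ~~ (z <= perp P y)%VS]].
Proof.
move=> xy dy; apply/setP => z; rewrite !inE.
case: (boolP (x <= z)%VS) => //= xz; case: eqP => //= dz.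
case: (boolP (ti z)) => //= tiz; rewrite /opposite_adj dz dy eqxx perp_sym /=.
case: (boolP (z <= _)%VS); rewrite ?andbF //= andbT => zy.
rewrite eqSS; apply/eqP/anti_leq; rewrite [X in _ && X]dimvS ?subv_cap ?xz // andbT.
rewrite leqNgt; apply: contra zy => lt.
have : (z == z :&: y)%VS by rewrite eq_sym eqEdim capvSl dz.
move/eqP => e; have : (z <= y)%VS by rewrite e capvSr.
move/subv_trans; apply.
have: (z == y)%VS by rewrite eqEdim dz dy leqnn andbT e capvSr.
by move/eqP => <-; apply: ti_perp.
Qed.

Lemma dim_cap_hyper x y : ti y -> (\dim (x :&: y)).+1 = \dim x ->
  ~~ (y <= perp P x)%VS -> (\dim (y :&: perp P x)).+1 = \dim y.
Proof.
move=> tiy dxy yx; have := leq_dim_ti_cap_perp ndP x tiy.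
have : (\dim (y :&: perp P x) < \dim y)%N.
  rewrite ltn_neqAle dimvS ?capvSl // andbT; apply: contra yx => /eqP e.
  have /eqP <- : (y :&: perp P x == y)%VS by rewrite eqEdim capvSl e leqnn.
  exact: capvSr.
lia.
Qed.

(** Such a z is spanned by x and the hyperplane z :&: y of y. Isotropy of z puts that hyperplane
    inside y :&: x^perp, also a hyperplane of y, so x + (y :&: x^perp) is the only candidate. *)
Lemma card_opposite_adj_above x y : ti x -> ti y -> \dim y = (\dim x).+1 ->
    ~~ (x <= y)%VS ->
  #|[set z | [&& (x <= z)%VS, \dim z == (\dim x).+1, ti z & opposite_adj z y]]| =
  ((\dim (x :&: y)).+1 == \dim x) && ~~ (y <= perp P x)%VS.
Proof.
move=> tix tiy dy xy.
have cap_eq z : (x <= z)%VS -> \dim z = (\dim x).+1 -> ti z -> opposite_adj z y ->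
    [/\ (\dim (x :&: y)).+1 = \dim x, ~~ (y <= perp P x)%VS
      & z = (x + (y :&: perp P x))%VS].
  move=> xz dz tiz /and3P[_ /eqP dzy yz].
  have xzy : (x + (z :&: y) <= z)%VS by rewrite subv_add xz capvSl.
  have zE : z = (x + (z :&: y))%VS.
    apply/eqP; rewrite eq_sym eqEdim xzy dz; rewrite ltnNge; apply: contra xy => le.
    have /eqP e : (x == x + (z :&: y))%VS by rewrite eqEdim addvSl.
    have /eqP <- : (z :&: y == x)%VS.
      by rewrite eqEdim e addvSr /= -e; lia.
    exact: capvSr.
  have dxy : (\dim (x :&: y)).+1 = \dim x.
    have := dimv_sum_cap x (z :&: y); rewrite -zE capvA (capv_idPl xz); lia.
  have yx : ~~ (y <= perp P x)%VS.
    apply: contra yz => yx; apply/subvP => u uy; rewrite zE mem_perpD (subvP yx) //=.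
    by apply: subvP uy; rewrite (subv_trans (ti_perp ndP tiy)) ?perpS ?capvSr.
  split=> //; rewrite {1}zE; congr (_ + _)%VS; apply/eqP; rewrite eqEdim.
  rewrite subv_cap capvSr /=; apply/andP; split.
    by rewrite (subv_trans (capvSl _ _)) // (subv_trans (ti_perp ndP tiz)) ?perpS.
  by have := dim_cap_hyper tiy dxy yx; lia.
case: eqP => [dxy|ndxy] /=; last first.
  apply: eq_card0 => z; rewrite inE; apply/negP => /and4P[a /eqP b c].
  by case/(cap_eq _ a b c).
have [yx|yx] /= := boolP (y <= perp P x)%VS.
  apply: eq_card0 => z; rewrite inE; apply/negP => /and4P[a /eqP b c].
  by case/(cap_eq _ a b c); rewrite yx.
apply/eqP/cards1P; exists (x + (y :&: perp P x))%VS; apply/setP => z; rewrite !inE.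
apply/and4P/eqP => [[a /eqP b c /(cap_eq _ a b c)[]]//|->].
have dyx := dim_cap_hyper tiy dxy yx.
have dz : \dim (x + (y :&: perp P x)) = (\dim x).+1.
  have := dimv_sum_cap x (y :&: perp P x).
  have -> : (x :&: (y :&: perp P x) = x :&: y)%VS.
    by rewrite [(y :&: _)%VS]capvC capvA (capv_idPl (ti_perp ndP tix)).
  lia.
have tiz : ti (x + (y :&: perp P x)).
  by rewrite tiD // tix capvSr (ti_sub ndP (capvSl _ _)).
split=> //; rewrite ?addvSl ?dz ?eqxx //; apply/and3P; split.
- by rewrite dz dy.
- rewrite dz eqSS; apply/eqP/anti_leq/andP; split.
    rewrite -ltnS -dz ltn_neqAle dimvS ?capvSl // andbT; apply: contra xy => /eqP e.
    have /eqP zE : ((x + (y :&: perp P x)) :&: y == x + (y :&: perp P x))%VS.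
      by rewrite eqEdim capvSl e leqnn.
    by apply: subv_trans (addvSl x (y :&: perp P x)) _; rewrite -zE capvSr.
  have -> : \dim x = \dim (y :&: perp P x) by lia.
  by rewrite dimvS // subv_cap addvSr capvSl.
- by apply: contra yx => /subv_trans; apply; rewrite perpS ?addvSl.
Qed.

(** Such a z lies strictly between x :&: y and y, which differ by two dimensions. Of the q + 1
    intermediate spaces only y :&: x^perp is orthogonal to x. Against the single path through a
    cover of x, this is the factor q in the commutation of [B] with [U]. *)
Lemma card_opposite_adj_below x y : ti x -> ti y -> \dim y = (\dim x).+1 ->
    ~~ (x <= y)%VS ->
  #|[set z | [&& (z <= y)%VS, (\dim z).+1 == \dim y, ti z & opposite_adj x z]]| =
  (q * (((\dim (x :&: y)).+1 == \dim x) && ~~ (y <= perp P x)%VS))%N.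
Proof.
move=> tix tiy dy xy.
have cap_eq z : (z <= y)%VS -> opposite_adj x z ->
    [/\ (\dim (x :&: y)).+1 = \dim x, ~~ (y <= perp P x)%VS & (x :&: y <= z)%VS].
  move=> zy /and3P[/eqP dxz /eqP dcap zx].
  have le : (x :&: z <= x :&: y)%VS by rewrite capvS.
  have dxy : (\dim (x :&: y)).+1 = \dim x.
    apply/anti_leq; rewrite -{2}dcap ltnS dimvS // andbT.
    rewrite ltn_neqAle dimvS ?capvSl // andbT; apply: contra xy => /eqP e.
    by have /eqP <- : (x :&: y == x)%VS; rewrite ?capvSr // eqEdim capvSl e leqnn.
  split=> //; first by apply: contra zx; apply: subv_trans.
  have /eqP <- : (x :&: z == x :&: y)%VS by rewrite eqEdim le; lia.
  exact: capvSr.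
case: eqP => [dxy|ndxy] /=; last first.
  rewrite muln0; apply: eq_card0 => z; rewrite inE; apply/negP.
  by case/and4P => a _ _ /(cap_eq _ a)[].
have [yx|yx] /= := boolP (y <= perp P x)%VS.
  rewrite muln0; apply: eq_card0 => z; rewrite inE; apply/negP.
  by case/and4P => a _ _ /(cap_eq _ a)[]; rewrite yx.
rewrite muln1.
have dyx := dim_cap_hyper tiy dxy yx.
set S := [set X | [&& (x :&: y <= X)%VS, \dim X == (\dim (x :&: y)).+1 & (X <= y)%VS]].
have cardS : #|S| = q.+1.
  have := @card_covers_below F n (x :&: y) y (capvSr _ _); rewrite -/S.
  have -> : (\dim y - \dim (x :&: y) = 2)%N by lia.
  have -> : (q ^ 2 - 1 = q.+1 * (q - 1))%N by rewrite mulnBr muln1 mulSn expnS expn1; lia.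
  by move/eqP; rewrite eqn_pmul2r ?subn_gt0 ?finNzRing_gt1 // => /eqP.
have memS : (y :&: perp P x)%VS \in S.
  rewrite inE capvSl subv_cap capvSr (subv_trans (capvSl _ _) (ti_perp ndP tix)) /=.
  by rewrite andbT; apply/eqP; lia.
rewrite (_ : [set z | _] = S :\ (y :&: perp P x)%VS).
  by have := cardsD1 (y :&: perp P x)%VS S; rewrite memS cardS add1n => -[].
apply/setP => z; rewrite !inE; apply/and4P/and4P.
  move=> [zy /eqP dz tiz adj]; have [_ _ xyz] := cap_eq z zy adj.
  move: adj => /and3P[/eqP dxz _ zx].
  split=> //; last by rewrite dxy dxz.
  by apply: contra zx => /eqP ->; rewrite capvSr.
move=> [ne xyz /eqP dz zy]; split=> //; first by rewrite dz dxy dy.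
  exact: (ti_sub ndP zy tiy).
have zNx : ~~ (z <= perp P x)%VS.
  apply: contra ne => zx.
  by rewrite eqEdim subv_cap zy zx dz dxy /= -ltnS dyx dy.
apply/and3P; split=> //; first by rewrite dz dxy.
rewrite -dxy eqSS; apply/eqP/anti_leq; rewrite dimvS ?capvS //=.
by rewrite dimvS // subv_cap capvSl.
Qed.

(** Each count is 0 or 1, with x :&: y and x + y as the only candidates. They differ exactly when x
    and y meet in a hyperplane but x + y is not isotropic. *)
Lemma card_down_up x y : ti x -> ti y -> \dim x = \dim y -> x <> y ->
  #|[set z | [&& (z <= x)%VS, (z <= y)%VS & (\dim z).+1 == \dim x]]| =
  (#|[set z | [&& (x <= z)%VS, (y <= z)%VS, \dim z == (\dim x).+1 & ti z]]|
   + opposite_adj x y)%N.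
Proof.
move=> tix tiy dxy xNy.
have lt_cap : (\dim (x :&: y) < \dim x)%N.
  rewrite ltn_neqAle dimvS ?capvSl // andbT; apply/eqP => e; apply: xNy.
  have /eqP xy : (x :&: y == x)%VS by rewrite eqEdim capvSl e leqnn.
  by apply/eqP; rewrite eqEdim -{1}xy capvSr dxy leqnn.
have dsum := dimv_sum_cap x y.
rewrite /opposite_adj dxy eqxx /= -dxy.
have -> : #|[set z | [&& (z <= x)%VS, (z <= y)%VS & (\dim z).+1 == \dim x]]| =
    ((\dim (x :&: y)).+1 == \dim x).
  case: eqP => [dc|dc].
    apply/eqP/cards1P; exists (x :&: y)%VS; apply/setP => z; rewrite !inE.
    apply/and3P/eqP => [[zx zy /eqP dz]|->]; last by rewrite capvSl capvSr dc eqxx.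
    by apply/eqP; rewrite eqEdim subv_cap zx zy /=; lia.
  apply: eq_card0 => z; rewrite inE; apply/negP => /and3P[zx zy /eqP dz]; apply: dc.
  by have : (\dim z <= \dim (x :&: y))%N; [rewrite dimvS // subv_cap zx | lia].
have -> : #|[set z | [&& (x <= z)%VS, (y <= z)%VS, \dim z == (\dim x).+1 & ti z]]| =
    ((\dim (x :&: y)).+1 == \dim x) && (y <= perp P x)%VS.
  case: eqP => [dc|dc] /=; last first.
    apply: eq_card0 => z; rewrite inE; apply/negP => /and4P[xz yz /eqP dz _]; apply: dc.
    by have : (\dim (x + y) <= \dim z)%N; [rewrite dimvS // subv_add xz | lia].
  have [yx|yx] := boolP (y <= perp P x)%VS; last first.
    apply: eq_card0 => z; rewrite inE; apply/negP => /and4P[xz yz _ tiz].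
    by case/negP: yx; rewrite (subv_trans yz) // (subv_trans (ti_perp ndP tiz)) ?perpS.
  apply/eqP/cards1P; exists (x + y)%VS; apply/setP => z; rewrite !inE.
  apply/and4P/eqP => [[xz yz /eqP dz _]|->].
    by apply/eqP; rewrite eq_sym eqEdim subv_add xz yz /=; lia.
  by rewrite addvSl addvSr tiD // tix tiy yx; split=> //; apply/eqP; lia.
by case: eqP => //= _; case: (y <= _)%VS.
Qed.
End PolarCovers.

(** * Matrices of relations between totally isotropic subspaces *)

Section RelationMatrix.
Variable R : comNzRingType.

Definition relmx (S T : finType) (r : S -> T -> R) : 'M[R]_(#|S|, #|T|) :=
  \matrix_(i, j) r (enum_val i) (enum_val j).

Lemma eq_relmx (S T : finType) (r s : S -> T -> R) :
  r =2 s -> relmx r = relmx s.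
Proof. by move=> rs; apply/matrixP => i j; rewrite !mxE. Qed.

Lemma tr_relmx (S T : finType) (r : S -> T -> R) :
  (relmx r)^T = relmx (fun x y => r y x).
Proof. by apply/matrixP => i j; rewrite !mxE. Qed.

Lemma mul_relmx (S T W : finType) (r : S -> T -> R) (s : T -> W -> R) :
  relmx r *m relmx s = relmx (fun x z => \sum_y r x y * s y z).
Proof.
apply/matrixP => i j; rewrite !mxE (reindex (@enum_val T predT)) /=; last first.
  by exists enum_rank => x _; rewrite ?enum_valK ?enum_rankK.
by apply: eq_bigr => k _; rewrite !mxE.
Qed.

Lemma mul_relmx_bool (S T W : finType) (r : S -> T -> bool) (s : T -> W -> bool) :
  relmx (fun x y => (r x y)%:R) *m relmx (fun x y => (s x y)%:R) =
  relmx (fun x z => #|[set y | r x y & s y z]|%:R).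
Proof.
rewrite mul_relmx; apply: eq_relmx => x z.
rewrite -sum1_card natr_sum [RHS]big_mkcond /=.
by apply: eq_bigr => y _; rewrite inE -natrM mulnb; case: (_ && _).
Qed.

Definition diagrel (T : finType) (g : T -> R) : 'M[R]_#|T| :=
  relmx (fun x y => (x == y)%:R * g x).

Lemma mul_diagrel_l (S T : finType) (g : S -> R) (r : S -> T -> R) :
  diagrel g *m relmx r = relmx (fun x y => g x * r x y).
Proof.
rewrite mul_relmx; apply: eq_relmx => x y; rewrite (bigD1 x) //= eqxx mul1r.
by rewrite big1 ?addr0 // => z /negPf zx; rewrite eq_sym zx !mul0r.
Qed.

Lemma mul_diagrel_r (S T : finType) (g : T -> R) (r : S -> T -> R) :
  relmx r *m diagrel g = relmx (fun x y => r x y * g y).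
Proof.
rewrite mul_relmx; apply: eq_relmx => x y; rewrite (bigD1 y) //= eqxx mul1r.
by rewrite big1 ?addr0 // => z /negPf zy; rewrite zy !mul0r mulr0.
Qed.

Lemma relmxB (S T : finType) (r s : S -> T -> R) :
  relmx r - relmx s = relmx (fun x y => r x y - s x y).
Proof. by apply/matrixP => i j; rewrite !mxE. Qed.

Lemma relmxZ (S T : finType) c (r : S -> T -> R) :
  c *: relmx r = relmx (fun x y => c * r x y).
Proof. by apply/matrixP => i j; rewrite !mxE. Qed.
End RelationMatrix.

(** * Commutation relations of the cover and relation matrices *)

Section PolarMatrices.
Variables (R : realFieldType) (F : finFieldType) (n : nat) (P : polar_form F n).
Hypothesis ndP : nondegenerate_form P.
Notation V := 'rV[F]_n.
Notation q := #|F|.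
Notation ti := (tot_isotropic P).
Notation T := {U : {vspace V} | ti U}.
Implicit Types (x y z : T).

Definition covers x y := (val x <= val y)%VS && (\dim (val y) == (\dim (val x)).+1).
Definition cover_mx : 'M[R]_#|{: T}| := relmx (fun x y => (covers x y)%:R).
Definition opposite_mx : 'M[R]_#|{: T}| :=
  relmx (fun x y => (opposite_adj P (val x) (val y))%:R).
Definition level_mx (g : nat -> R) : 'M[R]_#|{: T}| :=
  diagrel (fun x => g (\dim (val x))).

Lemma card_ti_set (p : pred {vspace V}) :
  #|[set z : T | p (val z)]| = #|[set X | p X & ti X]|.
Proof.
rewrite -(card_imset _ val_inj); apply: eq_card => X; rewrite !inE.
apply/imsetP/andP => [[z + ->]|[pX tiX]]; first by rewrite inE (valP z).
by exists (Sub X tiX); rewrite ?inE SubK.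
Qed.

Lemma cover_tr : cover_mx^T = relmx (fun x y => (covers y x)%:R).
Proof. exact: tr_relmx. Qed.

Lemma level_mx_tr g : (level_mx g)^T = level_mx g.
Proof.
rewrite [LHS]tr_relmx; apply: eq_relmx => x y; rewrite eq_sym.
by have [->|] := eqVneq x y; rewrite ?mul0r.
Qed.

(** The level scalars stay abstract: [mu_rec] is the entry of [opposite_cover] at a covering pair
    and [lam_rec] the diagonal entry of [down_sub_up]. The other entries of both identities do not
    involve [mu] or [lam]. *)
Variables mu lam : nat -> R.

Hypothesis mu_rec : forall s U : {vspace V}, ti U -> (s <= U)%VS ->
  \dim U = (\dim s).+1 ->
  q%:R * (mu (\dim U) - #|[set X | [&& (s <= X)%VS, \dim X == (\dim s).+1 &
                  ti X && ~~ (X <= perp P U)%VS]]|%:R) = mu (\dim s).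

Hypothesis lam_rec : forall s : {vspace V}, ti s ->
  #|[set X | (X <= s)%VS && ((\dim X).+1 == \dim s)]|%:R
  - #|[set X | [&& (s <= X)%VS, \dim X == (\dim s).+1 & ti X]]|%:R =
  lam (\dim s) - lam (\dim s).+1 - mu (\dim s).

Let U := cover_mx.
Let B := opposite_mx - level_mx mu.
Let X := U^T *m U - level_mx lam.

Lemma shifted_opposite_tr : B^T = B.
Proof.
rewrite /B linearB /= level_mx_tr tr_relmx; congr (_ - _).
by apply: eq_relmx => x y; rewrite opposite_adjC.
Qed.

(** The argument of [lam] moves up by one so that, with [cover_level], both U X and (X - B) U become
    U U^T U minus the same level term. *)
Lemma down_sub_up : X - B = U *m U^T - level_mx (fun a => lam a.+1).
Proof.
rewrite /X /B /U cover_tr /cover_mx !mul_relmx_bool /opposite_mx /level_mx /diagrel.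
rewrite !relmxB; apply: eq_relmx => x y.
have [<-|xy] := eqVneq x y.
  rewrite !mul1r.
  have -> : opposite_adj P (val x) (val x) = false.
    by rewrite /opposite_adj capvv eqxx [_.+1 == _]gtn_eqF.
  have := lam_rec (valP x).
  have -> : #|[set z | covers z x & covers z x]| =
      #|[set X0 | (X0 <= val x)%VS && ((\dim X0).+1 == \dim (val x))]|.
    rewrite (card_ti_set (fun X0 => (((X0 <= val x)%VS && (\dim (val x) == (\dim X0).+1)))
      && ((X0 <= val x)%VS && (\dim (val x) == (\dim X0).+1)))).
    apply: eq_card => X0; rewrite !inE andbb [(_.+1 == _)]eq_sym.
    have [Xx|] := boolP (X0 <= val x)%VS; last by [].
    by rewrite (ti_sub ndP Xx (valP x)) andbT.
  have -> : #|[set z | covers x z & covers x z]| =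
      #|[set X0 | [&& (val x <= X0)%VS, \dim X0 == (\dim (val x)).+1 & ti X0]]|.
    rewrite (card_ti_set (fun X0 => (((val x <= X0)%VS && (\dim X0 == (\dim (val x)).+1)))
      && ((val x <= X0)%VS && (\dim X0 == (\dim (val x)).+1)))).
    by apply: eq_card => X0; rewrite !inE andbb andbA.
  move: (#|_|%:R) (#|_|%:R) => M N; rewrite mulr0n; lra.
rewrite !mul0r !subr0.
have [dxy|dxy] := eqVneq (\dim (val x)) (\dim (val y)); last first.
  rewrite (_ : [set z | _ & _] = set0); last first.
    apply/setP => z; rewrite !inE; apply/negP.
    move=> /andP[/andP[_ /eqP e1] /andP[_ /eqP e2]].
    by rewrite e1 e2 eqxx in dxy.
  rewrite (_ : [set z | _ & _] = set0); last first.
    apply/setP => z; rewrite !inE; apply/negP.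
    move=> /andP[/andP[_ /eqP e1] /andP[_ /eqP e2]].
    by move: dxy; rewrite -eqSS -e1 -e2 eqxx.
  by rewrite /opposite_adj (negPf dxy) subr0.
have := card_down_up ndP (valP x) (valP y) dxy.
have -> : #|[set z | covers z x & covers z y]| =
   #|[set z | [&& (z <= val x)%VS, (z <= val y)%VS & (\dim z).+1 == \dim (val x)]]|.
  rewrite (card_ti_set (fun X0 => (((X0 <= val x)%VS && (\dim (val x) == (\dim X0).+1)))
      && ((X0 <= val y)%VS && (\dim (val y) == (\dim X0).+1)))).
  apply: eq_card => X0; rewrite !inE -dxy [(_.+1 == _)]eq_sym.
  have [Xx|] := boolP (X0 <= val x)%VS; last by [].
  rewrite (ti_sub ndP Xx (valP x)) andbT /=.
  by case: (_ == _); rewrite ?andbF ?andbT.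
have -> : #|[set z | covers x z & covers y z]| =
   #|[set z | [&& (val x <= z)%VS, (val y <= z)%VS, \dim z == (\dim (val x)).+1 & ti z]]|.
  rewrite (card_ti_set (fun X0 => (((val x <= X0)%VS && (\dim X0 == (\dim (val x)).+1)))
      && ((val y <= X0)%VS && (\dim X0 == (\dim (val y)).+1)))).
  apply: eq_card => X0; rewrite !inE -dxy.
  by case: (_ <= _)%VS; case: (_ <= _)%VS; case: (_ == _).
move=> -> ; last by move=> e; rewrite (val_inj e) eqxx in xy.
by rewrite natrD addrK.
Qed.

Lemma opposite_cover : B *m U = q%:R *: (U *m B).
Proof.
rewrite /B mulmxBl mulmxBr /opposite_mx /level_mx /U /cover_mx.
rewrite !mul_relmx_bool mul_diagrel_l mul_diagrel_r !relmxB relmxZ.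
apply: eq_relmx => x y.
have belowE : #|[set z | opposite_adj P (val x) (val z) & covers z y]| =
  #|[set z : {vspace V} | [&& (z <= val y)%VS, (\dim z).+1 == \dim (val y), ti z &
              opposite_adj P (val x) z]]|.
  rewrite (card_ti_set (fun z : {vspace V} => opposite_adj P (val x) z &&
    ((z <= val y)%VS && (\dim (val y) == (\dim z).+1)))).
  apply: eq_card => z; rewrite !inE [_.+1 == _]eq_sym.
  by case: (ti z); rewrite ?andbF ?andbT //= andbC andbA.
have aboveE : #|[set z | covers x z & opposite_adj P (val z) (val y)]| =
  #|[set z : {vspace V} | [&& (val x <= z)%VS, \dim z == (\dim (val x)).+1, ti z &
              opposite_adj P z (val y)]]|.
  rewrite (card_ti_set (fun z : {vspace V} =>
    ((val x <= z)%VS && (\dim z == (\dim (val x)).+1)) && opposite_adj P z (val y))).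
  apply: eq_card => z; rewrite !inE.
  by case: (ti z); rewrite ?andbF ?andbT //= andbA.
rewrite belowE aboveE.
have [dxy|dxy] := eqVneq (\dim (val y)) (\dim (val x)).+1; last first.
  rewrite /covers (negPf dxy) andbF mulr0 mul0r !subr0.
  rewrite (_ : [set z | _] = set0); last first.
    apply/setP => z; rewrite !inE; apply/negP => /and4P[_ /eqP e _ /and3P[/eqP e' _ _]].
    by rewrite -e e' eqxx in dxy.
  rewrite (_ : [set z | _] = set0); last first.
    apply/setP => z; rewrite !inE; apply/negP => /and4P[_ /eqP e _ /and3P[/eqP e' _ _]].
    by rewrite -e' e eqxx in dxy.
  by rewrite cards0 mulr0.
have [xy|xy] := boolP (val x <= val y)%VS; last first.
  rewrite (card_opposite_adj_below ndP (valP x) (valP y) dxy xy).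
  rewrite (card_opposite_adj_above ndP (valP x) (valP y) dxy xy).
  by rewrite /covers (negPf xy) mulr0 mul0r !subr0 natrM.
rewrite (opposite_adj_cover_sub ndP (valP y) xy) cards0.
rewrite (opposite_adj_sub_cover ndP xy dxy).
rewrite /covers xy dxy eqxx mulr1 mul1r sub0r.
have := mu_rec (valP y) xy dxy; rewrite dxy => <-.
by rewrite -mulrN opprB.
Qed.

Lemma cover_level (g : nat -> R) : U *m level_mx g = level_mx (fun a => g a.+1) *m U.
Proof.
rewrite /U /cover_mx mul_diagrel_l mul_diagrel_r; apply: eq_relmx => x y.
by rewrite /covers mulrC; case: eqP => [->|]; rewrite ?andbF ?mulr0.
Qed.
End PolarMatrices.

(** * From the incidence maps to powers of the cover matrix *)

Section Incidence.
Variables (F : finFieldType) (n : nat) (P : polar_form F n).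
Hypothesis ndP : nondegenerate_form P.
Variable R : realType.
Notation V := 'rV[F]_n.
Notation q := #|F|.
Notation ti := (tot_isotropic P).
Notation T := {U : {vspace V} | ti U}.
Notation U := (cover_mx R P).
Implicit Types (x y z : T) (a b : int).

(** An entry counts maximal chains from x to y, and their number depends only on k. Its value is
    irrelevant, since images and kernels ignore nonzero factors. *)
Lemma cover_pow k : exists2 g : R, 0 < g &
  U ^+ k = relmx (fun x y =>
    g * ((val x <= val y)%VS && (\dim (val y) == \dim (val x) + k)%N)%:R).
Proof.
elim: k => [|k [g g_gt0 IHk]].
  exists 1 => //; rewrite expr0; apply/matrixP => i j; rewrite !mxE mul1r addn0.
  congr (_ %:R); congr nat_of_bool; rewrite -(inj_eq enum_val_inj).
  apply/eqP/andP => [->|[xy /eqP dxy]]; first by rewrite subvv eqxx.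
  by apply/val_inj/eqP; rewrite eqEdim xy dxy leqnn.
have q_gt1 : 1 < q%:R :> R by rewrite ltr1n finNzRing_gt1.
exists (g * ((q%:R ^+ k.+1 - 1) / (q%:R - 1))).
  by rewrite mulr_gt0 // divr_gt0 ?subr_gt0 // exprn_egt1.
rewrite exprS IHk [LHS]mul_relmx; apply: eq_relmx => x y.
under eq_bigr => z _ do rewrite mulrCA -natrM mulnb.
rewrite -mulr_sumr -mulrA -natr_sum; congr (_ * _).
have -> : (\sum_z (covers x z && ((val z <= val y)%VS &&
      (\dim (val y) == \dim (val z) + k)%N)) =
    #|[set z : T | covers x z && ((val z <= val y)%VS &&
      (\dim (val y) == \dim (val z) + k)%N)]|)%N.
  rewrite -sum1_card [RHS]big_mkcond; apply: eq_bigr => z _; rewrite inE.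
  by case: (covers x z && _).
case: (boolP (val x <= val y)%VS) => xy /=; last first.
  rewrite mulr0 (_ : [set z | _] = set0) ?cards0 //; apply/setP => z; rewrite !inE.
  apply/negP => /andP[/andP[xz _] /andP[zy _]].
  by rewrite (subv_trans xz zy) in xy.
case: eqP => dxy; last first.
  rewrite mulr0 (_ : [set z | _] = set0) ?cards0 //; apply/setP => z; rewrite !inE.
  apply/negP => /andP[/andP[_ /eqP dz] /andP[_ /eqP dy]].
  by apply: dxy; rewrite dy dz addSn addnS.
rewrite mulr1; apply: (mulIf (x := q%:R - 1)); first by rewrite gt_eqF // subr_gt0.
rewrite divfK ?gt_eqF ?subr_gt0 //.
have cb := card_covers_below xy; rewrite dxy addKn in cb; move: cb.
have -> :
    #|[set X | [&& (val x <= X)%VS, \dim X == (\dim (val x)).+1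
                 & (X <= val y)%VS]]| =
    #|[set z | covers x z & (val z <= val y)%VS &&
                            (\dim (val y) == \dim (val z) + k)%N]|.
  rewrite (card_ti_set P (fun z : {vspace V} =>
    ((val x <= z)%VS && (\dim z == (\dim (val x)).+1)) &&
    ((z <= val y)%VS && (\dim (val y) == \dim z + k)%N))).
  apply: eq_card => z; rewrite !inE -!andbA; congr (_ && _).
  case: eqP => //= ->; rewrite dxy addSn addnS eqxx /=.
  by case: (boolP (z <= _)%VS) => //= zy; rewrite (ti_sub ndP zy (valP y)).
move/(congr1 (fun m : nat => m%:R : R)).
have q_gt0 : (0 < q)%N by rewrite ltnW // finNzRing_gt1.
by rewrite natrM !natrB ?expn_gt0 ?q_gt0 // natrX.
Qed.

(** Extension by zero from level a to all levels. It has no rows when no totally isotropic subspace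
    has dimension a, which handles the levels -1 and d+1. *)
Definition Omega_mx a : 'M[R]_(#|{: Omega P a}|, #|{: T}|) :=
  relmx (fun (w : Omega P a) (x : T) => (val w == val x)%:R).

Lemma valP_Omega a (w : Omega P a) : ti (val w) /\ (\dim (val w))%:Z = a.
Proof. by have /andP[-> /eqP ->] := valP w. Qed.

Definition ti_of a (w : Omega P a) : T := Sub (val w) (proj1 (valP_Omega w)).

Lemma Omega_mx_mul a (S : finType) (r : T -> S -> R) :
  Omega_mx a *m relmx r = relmx (fun (w : Omega P a) (s : S) => r (ti_of w) s).
Proof.
rewrite mul_relmx; apply: eq_relmx => w y; rewrite (bigD1 (ti_of w)) //= eqxx mul1r.
rewrite big1 ?addr0 // => z zw; case: eqP => [e|]; last by rewrite mul0r.
by case/eqP: zw; apply: val_inj => /=; rewrite -e.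
Qed.

Lemma Omega_mxK a : Omega_mx a *m (Omega_mx a)^T = 1%:M.
Proof.
rewrite tr_relmx Omega_mx_mul //; apply/matrixP => i j; rewrite !mxE /=.
by rewrite (inj_eq val_inj) eq_sym (inj_eq enum_val_inj).
Qed.

Lemma Omega_mx_level a g c : (forall k : nat, k%:Z = a -> g k = c) ->
  Omega_mx a *m level_mx P g = c *: Omega_mx a.
Proof.
move=> gc; rewrite /level_mx /diagrel Omega_mx_mul // relmxZ; apply: eq_relmx => w y.
rewrite -(inj_eq val_inj) /= mulrC.
have [e|] := eqVneq (val w) (val y); last by rewrite !mulr0.
by rewrite !mulr1 gc //; case: (valP_Omega w).
Qed.

Lemma incidence_rel a b (w : Omega P a) (z : Omega P b) :
  polar_rel (Num.min a b) (Num.max a b) w z =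
  if a <= b then (val w <= val z)%VS else (val z <= val w)%VS.
Proof.
have [tiw dw] := valP_Omega w; have [tiz dz] := valP_Omega z.
rewrite /polar_rel; case: ifP => ab.
  rewrite (min_idPl ab) (max_idPr ab).
  apply/andP/idP => [[/eqP e _]|wz].
    have : (val w :&: val z == val w)%VS.
      by rewrite eqEdim capvSl -lez_nat e dw lexx.
    by move/eqP <-; apply: capvSr.
  rewrite (capv_idPl wz) dw eqxx; split=> //.
  have zw : (val z <= perp P (val w))%VS.
    by apply: subv_trans (ti_perp ndP tiz) (perpS _ wz).
  by rewrite (capv_idPl zw) (addv_idPr wz) dz.
have {}ab : b <= a by rewrite ltW // ltNge ab.
rewrite (min_idPr ab) (max_idPl ab).
apply/andP/idP => [[/eqP e _]|zw].
  have : (val w :&: val z == val z)%VS.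
    by rewrite eqEdim capvSr -lez_nat e dz lexx.
  by move/eqP <-; apply: capvSl.
rewrite (capv_idPr zw) dz eqxx; split=> //.
have zw' : (val z <= perp P (val w))%VS by apply: subv_trans zw (ti_perp ndP tiw).
by rewrite (capv_idPl zw') (addv_idPl zw) dw.
Qed.

Lemma subv_eqdim_sym (X Y : {vspace V}) :
  \dim X = \dim Y -> (X <= Y)%VS = (Y <= X)%VS.
Proof.
move=> dXY; have := eqEdim X Y; have := eqEdim Y X.
by rewrite dXY leqnn !andbT => <- <-; rewrite eq_sym.
Qed.

Lemma Cinc_tr a b : (Cinc P R a b)^T = Cinc P R b a.
Proof.
rewrite /Cinc /Crel; apply/matrixP => i j; rewrite !mxE !incidence_rel.
congr (_ %:R); congr nat_of_bool.
case: (ltgtP a b) => // ab; move: (enum_val i) (enum_val j); rewrite ab => w z.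
have [_ dw] := valP_Omega w; have [_ dz] := valP_Omega z.
have dwz : \dim (val w) = \dim (val z) by apply/eqP; rewrite -eqz_nat dw dz.
exact: subv_eqdim_sym.
Qed.

Lemma Cinc_Omega_mx a b : Cinc P R b a *m Omega_mx b =
  relmx (fun (w : Omega P a) (y : T) => (((\dim (val y))%:Z == b) &&
     (if b <= a then (val y <= val w)%VS else (val w <= val y)%VS))%:R).
Proof.
rewrite /Cinc [X in X *m _](_ : _ = relmx (fun (w : Omega P a) (z : Omega P b) =>
  (if b <= a then (val z <= val w)%VS else (val w <= val z)%VS)%:R)); last first.
  by apply/matrixP => i j; rewrite !mxE incidence_rel.
rewrite mul_relmx; apply: eq_relmx => w y.
have [dy|dy] /= := eqVneq _ b; last first.
  rewrite big1 // => z _; case: eqP => [e|]; last by rewrite mulr0.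
  by case/eqP: dy; rewrite /= -e; case: (valP_Omega z).
have tiy : tot_isotropic P (val y) && ((\dim (val y))%:Z == b).
  by rewrite (valP y) dy eqxx.
pose z0 : Omega P b := Sub (val y) tiy.
rewrite (bigD1 z0) //= eqxx mulr1 big1 ?addr0 // => z zz0.
case: eqP => [e|]; last by rewrite mulr0.
by case/eqP: zz0; apply: val_inj => /=; rewrite e.
Qed.

Lemma Omega_mx_up a k : exists2 g : R, g != 0 &
  Omega_mx a *m U ^+ k = g *: (Cinc P R (a + k%:Z) a *m Omega_mx (a + k%:Z)).
Proof.
have [g g_gt0 ->] := cover_pow k; exists g; first by rewrite gt_eqF.
rewrite Cinc_Omega_mx Omega_mx_mul // relmxZ; apply: eq_relmx => w y /=.
congr (_ * _%:R); congr nat_of_bool; rewrite andbC; have [_] := valP_Omega w.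
case: w => W /= _ dW; rewrite -dW -PoszD eqz_nat; case: eqP => //= dy.
case: ifP => // le; have k0 : k = 0%N by lia.
have dWy : \dim W = \dim (val y) by rewrite /= dy k0 addn0.
exact: subv_eqdim_sym.
Qed.

Lemma Omega_mx_down a k : exists2 g : R, g != 0 &
  Omega_mx a *m U^T ^+ k = g *: (Cinc P R (a - k%:Z) a *m Omega_mx (a - k%:Z)).
Proof.
have [g g_gt0 Uk] := cover_pow k; exists g; first by rewrite gt_eqF.
rewrite -trmxX Uk tr_relmx Cinc_Omega_mx Omega_mx_mul // relmxZ.
apply: eq_relmx => w y /=.
congr (_ * _%:R); congr nat_of_bool; rewrite andbC; have [_] := valP_Omega w.
case: w => W /= _ dW; rewrite -dW ifT; last by lia.
by congr (_ && _); apply/eqP/eqP; lia.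
Qed.

(** If Y is not orthogonal to W, then Y :&: W^perp shrinks to W :&: Y and the span is W; otherwise
    the span is W + Y, one dimension too large. *)
Lemma polar_rel_opposite (W Y : {vspace V}) : ti W -> ti Y -> \dim W = \dim Y ->
  ((\dim (W :&: Y))%:Z == (\dim W)%:Z - 1) &&
  ((\dim (W + (Y :&: perp P W)))%:Z == (\dim W)%:Z) = opposite_adj P W Y.
Proof.
move=> tiW tiY dWY; rewrite /opposite_adj dWY eqxx /= -dWY.
have -> : ((\dim (W :&: Y))%:Z == (\dim W)%:Z - 1) = ((\dim (W :&: Y)).+1 == \dim W).
  by apply/eqP/eqP; lia.
case: eqP => //= dWY1; have dsum := dimv_sum_cap W Y.
have [YW|YW] /= := boolP (Y <= perp P W)%VS.
  by rewrite (capv_idPl YW); apply/negbTE/eqP; lia.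
have dYW := dim_cap_hyper ndP tiY dWY1 YW.
have /eqP <- : (W :&: Y == Y :&: perp P W)%VS.
  by rewrite eqEdim subv_cap capvSr (subv_trans (capvSl _ _) (ti_perp ndP tiW)) /=; lia.
by rewrite (addv_idPl (capvSl _ _)) eqxx.
Qed.

Lemma Crel_Omega_mx a : (Crel P R a a (a - 1) a)^T *m Omega_mx a =
  Omega_mx a *m opposite_mx R P.
Proof.
have -> : (Crel P R a a (a - 1) a)^T =
    relmx (fun w z : Omega P a => (polar_rel (a - 1) a w z)%:R).
  by apply/matrixP => i j; rewrite !mxE.
rewrite Omega_mx_mul mul_relmx; apply: eq_relmx => w y /=.
have [tiw dw] := valP_Omega w.
have [dy|dy] /= := eqVneq (\dim (val y))%:Z a; last first.
  rewrite big1 => [|z _]; last first.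
    case: eqP => [e|]; last by rewrite mulr0.
    by case/eqP: dy; rewrite /= -e; case: (valP_Omega z).
  rewrite /opposite_adj; case: eqP => //= e; case/eqP: dy.
  by rewrite /= -e.
have tiy : tot_isotropic P (val y) && ((\dim (val y))%:Z == a).
  by rewrite (valP y) dy eqxx.
pose z0 : Omega P a := Sub (val y) tiy.
rewrite (bigD1 z0) //= eqxx mulr1 big1 ?addr0 => [|z zz0]; last first.
  case: eqP => [e|]; last by rewrite mulr0.
  by case/eqP: zz0; apply: val_inj => /=; rewrite e.
congr (_%:R); congr nat_of_bool; rewrite -polar_rel_opposite //.
- by rewrite dw.
- exact: valP y.
- by apply/eqP; rewrite -eqz_nat dw dy.
Qed.
End Incidence.

(** * The eigenvalue *)

Section Eigenvalue.
Variable R : realType.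

(* Here [eps], [Q], [rho], [iota], [x] stand for [q^e], [q^d], [q^r], [q^i] and
   [q^a], so that no negative exponents occur above level [d - i]. *)
Definition level_eigenvalue (q eps Q rho iota x : R) : R :=
  ((x / rho - 1) * (Q ^+ 2 * eps / x ^+ 2)
   - (rho - 1 - (iota - 1) * (iota * eps / q + 1)) * (Q / (x * iota))) / (q - 1).

(* The scalar by which [U^T *m U] acts at level [a], as a function of
   [x = q ^+ a], on the constituent living on the levels [r], ..., [d - i]:
   hence the roots [q^r] and [q^(d-i+1)]. The third root is forced by
   [level_shift_rec]. *)
Definition level_shift (q eps Q rho iota x : R) : R :=
  - ((x - rho) * (x - q * Q / iota) * (x + Q * eps * iota / rho))
    / ((q - 1) ^+ 2 * x ^+ 2).

Section Recursions.
Variables (q eps Q rho iota x : R).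
Hypotheses (q_gt1 : 1 < q) (Q_gt0 : 0 < Q) (rho_gt0 : 0 < rho).
Hypotheses (iota_gt0 : 0 < iota) (x_gt0 : 0 < x).

(** The number of singular vectors in U^perp for a totally isotropic U with q^(dim U) = x, as found
    in [card_singular_perp_real]. *)
Let sing x := Q + eps * Q ^+ 2 / (q * x) - eps * Q / q.
Let mu := level_eigenvalue q eps Q rho iota.
Let lam := level_shift q eps Q rho iota.

Let q_neq0 : q != 0. Proof. by rewrite gt_eqF // (lt_trans ltr01). Qed.
Let q1_neq0 : q - 1 != 0. Proof. by rewrite subr_eq0 gt_eqF. Qed.
Let Q_neq0 : Q != 0. Proof. by rewrite gt_eqF. Qed.
Let rho_neq0 : rho != 0. Proof. by rewrite gt_eqF. Qed.
Let iota_neq0 : iota != 0. Proof. by rewrite gt_eqF. Qed.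
Let x_neq0 : x != 0. Proof. by rewrite gt_eqF. Qed.

Lemma level_eigenvalue_rec kappa :
    kappa * (q * x - x) + sing (q * x) = sing x ->
  q * (mu (q * x) - kappa) = mu x.
Proof.
move=> e; have -> : kappa = (sing x - sing (q * x)) / (x * (q - 1)).
  by rewrite -e addrK; field; rewrite q1_neq0 x_neq0.
rewrite /mu /level_eigenvalue /sing; field.
by rewrite ?q_neq0 ?q1_neq0 ?rho_neq0 ?iota_neq0 ?x_neq0.
Qed.

Lemma level_shift_rec h N :
    h * (q - 1) = x - 1 -> N * (q * x - x) + x = sing x ->
  h - N = lam x - lam (q * x) - mu x.
Proof.
move=> eh eN; have -> : h = (x - 1) / (q - 1) by rewrite -eh mulfK.
have -> : N = (sing x - x) / (x * (q - 1)).
  by rewrite -eN addrK; field; rewrite q1_neq0 x_neq0.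
rewrite /mu /lam /level_eigenvalue /level_shift /sing; field.
by rewrite ?q_neq0 ?q1_neq0 ?rho_neq0 ?iota_neq0 ?x_neq0.
Qed.
End Recursions.

Lemma gauss_binom1 (q : R) m : gauss_binom q m 1 = (q ^+ m - 1) / (q - 1).
Proof. by rewrite /gauss_binom big_ord1 subn0 expr1. Qed.
End Eigenvalue.

(** The six types meet in this identity. It eliminates both n and the coset ratio from the count of
    singular vectors, leaving only q, d and e. *)
Lemma coset_ratio_param (R : realType) (F : finFieldType) n (P : polar_form F n) t d :
    classical_polar_space P t d ->
  (coset_ratio P)%:R * #|F|%:R `^ (polar_param R t) * #|F|%:R ^+ (2 * d)
    = #|F|%:R ^+ n.+1 :> R.
Proof.
move=> [nd ft nE _].
have q_gt0 : 0 < #|F|%:R :> R by rewrite ltr0n ltnW // finNzRing_gt1.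
have q_neq0 : #|F|%:R != 0 :> R by rewrite gt_eqF.
have powS (b : R) : #|F|%:R `^ (1 + b) = #|F|%:R * #|F|%:R `^ b.
  by rewrite powRD ?q_neq0 ?implybT // powRr1 // ltW.
have half (theta : involutive_rmorphism F) : ~ (theta =1 id) ->
    #|[set x | theta x == x]|%:R = #|F|%:R `^ (1 / 2) :> R.
  move=> /involution_trace[/(congr1 (fun m : nat => m%:R : R)) sq _].
  rewrite div1r powR12_sqrt ?ltW // -sq natrM -expr2 sqrtr_sqr ger0_norm //.
have halfK : #|F|%:R `^ (1 / 2) * #|F|%:R `^ (1 / 2) = #|F|%:R :> R.
  by rewrite div1r powR12_sqrt ?ltW // -expr2 sqr_sqrtr // ltW.
case: P nd ft => [Q|theta f|f] /= nd; case: t nE => //= nE _; rewrite nE.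
- by rewrite powRr0 mulr1 exprS.
- by rewrite powRr1 ?ltW // addn1 !exprS; ring.
- have -> : 2 = 1 + 1 :> R by []. 
  by rewrite powS powRr1 ?ltW // addn2 !exprS; ring.
- by rewrite half ?halfK ?exprS //; case: nd.
- rewrite half; last by case: nd.
  have -> : 3 / 2 = 1 + 1 / 2 :> R by field.
  by rewrite powS addn1 mulrCA halfK !exprS; ring.
- by rewrite powRr1 ?ltW // mul1r exprS.
Qed.

Lemma card_singular_perp_real (R : realType) (F : finFieldType) n
    (P : polar_form F n) t d (U : {vspace 'rV[F]_n}) :
    classical_polar_space P t d -> tot_isotropic P U ->
  let q : R := #|F|%:R in let eps := q `^ (polar_param R t) in
  #|[set v in perp P U | singular P v]|%:R =
  q ^+ d + eps * (q ^+ d) ^+ 2 / (q * q ^+ \dim U) - eps * q ^+ d / q.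
Proof.
move=> hP tiU q eps; have [ndP _ nE rankP] := hP.
have q_gt0 : 0 < q by rewrite ltr0n ltnW // finNzRing_gt1.
have q_neq0 : q != 0 by rewrite gt_eqF.
have ratio := coset_ratio_param R hP; rewrite -/q -/eps in ratio.
have xi_neq0 : (coset_ratio P)%:R != 0 :> R.
  by rewrite pnatr_eq0 -lt0n coset_ratio_gt0.
have := congr1 (fun m : nat => m%:R : R) (card_singular_perp ndP rankP tiU).
rewrite !natrD !natrM !natrX -/q.
have q_exp k : (k <= n)%N -> q ^+ (n - k) = q ^+ n / q ^+ k.
  by move=> kn; apply: (canRL (mulfK _)); rewrite ?expf_neq0 // -exprD subnK.
rewrite !q_exp; first last.
- by rewrite nE; case: (t); rewrite /=; lia.
- by have := dim_perp ndP tiU; lia.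
have -> : q ^+ n = (coset_ratio P)%:R * eps * (q ^+ d) ^+ 2 / q.
  by apply: (canRL (mulfK _)) => //; rewrite -exprSr -ratio -exprM mulnC.
have Q_neq0 : q ^+ d != 0 by rewrite expf_neq0.
have x_neq0 : q ^+ \dim U != 0 by rewrite expf_neq0.
move: (q ^+ d) (q ^+ \dim U) ((coset_ratio P)%:R) xi_neq0 Q_neq0 x_neq0.
move=> Q x xi xi_neq0 Q_neq0 x_neq0.
move: (#|_|%:R) => S /(canRL (addrK _)) /(canRL (mulfK xi_neq0)) ->.
by field; apply/and4P; split.
Qed.

Lemma level_eigenvalueE (R : realType) (q e : R) (d a r i : nat) : 1 < q ->
    (r <= a)%N ->
  gauss_binom q (a - r) 1 * q `^ (2 * d%:R - 2 * a%:R + e)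
    - (gauss_binom q r 1 - gauss_binom q i 1 * (q `^ (i%:R - 1 + e) + 1))
      * q `^ (d%:R - a%:R - i%:R) =
  level_eigenvalue q (q `^ e) (q ^+ d) (q ^+ r) (q ^+ i) (q ^+ a).
Proof.
move=> q_gt1 ra; have q_gt0 : 0 < q := lt_trans ltr01 q_gt1.
have q_neq0 : q != 0 by rewrite gt_eqF.
have q1_neq0 : q - 1 != 0 by rewrite subr_eq0 gt_eqF.
have powD (x y : R) : q `^ (x + y) = q `^ x * q `^ y.
  by rewrite powRD // q_neq0 implybT.
have qX k : q ^+ k != 0 by rewrite expf_neq0.
rewrite !gauss_binom1 /level_eigenvalue.
have -> : q ^+ (a - r) = q ^+ a / q ^+ r.
  by apply: (canRL (mulfK _)); rewrite // -exprD subnK.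
rewrite !powD !powRN -!natrM !powR_mulrn ?(ltW q_gt0) // powRr1 ?(ltW q_gt0) //.
rewrite ![(2 * _)%N]mulnC !exprM.
move: (q ^+ d) (q ^+ a) (q ^+ r) (q ^+ i) (q `^ e) (qX a) (qX r) (qX i).
by move=> Q x rho iota eps x0 rho0 iota0; field; apply/and5P; split.
Qed.

Theorem theorem4p9 (R : realType) (F : finFieldType) (n : nat)
    (P : polar_form F n) (t : polar_type) (d : nat)
    (hd : (2 <= d)%N) (hP : classical_polar_space P t d)
    (a r i : nat) (ha1 : (1 <= a)%N) (had : (a <= d - 1)%N)
    (hr : (r <= a)%N) (hi : (i <= minn r (d - a))%N) :
  let q : R := #|F|%:R in
  let e : R := polar_param R t in
  (Vsp P R d%:Z a%:Z r%:Z i%:Z <=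
     eigenspace (Crel P R a%:Z a%:Z (a%:Z - 1) a%:Z)^T
       (gauss_binom q (a - r) 1 * q `^ (2 * d%:R - 2 * a%:R + e)
        - (gauss_binom q r 1 - gauss_binom q i 1 * (q `^ (i%:R - 1 + e) + 1))
          * q `^ (d%:R - a%:R - i%:R)))%MS.
Proof.
lazy zeta; set q : R := #|F|%:R; set e : R := polar_param R t.
have [ndP _ _ rankP] := hP.
have q_gt1 : 1 < q by rewrite ltr1n finNzRing_gt1.
have q_gt0 : 0 < q := lt_trans ltr01 q_gt1.
have qX_gt0 k : 0 < q ^+ k by rewrite exprn_gt0.
rewrite level_eigenvalueE //; set eps := q `^ e.
have [ir ida] : (i <= r)%N /\ (i <= d - a)%N by apply/andP; rewrite -leq_min.
pose f (h : R -> R -> R -> R -> R -> R -> R) m :=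
  h q eps (q ^+ d) (q ^+ r) (q ^+ i) (q ^+ m).
pose mu := f (@level_eigenvalue R); pose lam := f (@level_shift R).
rewrite -[level_eigenvalue _ _ _ _ _ _]/(mu a).
have sing (U : {vspace 'rV[F]_n}) (tiU : tot_isotropic P U) :=
  @card_singular_perp_real R F n P t d U hP tiU.
have dq (U : {vspace 'rV[F]_n}) :
    (#|F| ^ (\dim U).+1 - #|F| ^ \dim U)%:R = q * q ^+ \dim U - q ^+ \dim U :> R.
  by rewrite natrB ?leq_exp2l ?finNzRing_gt1 // !natrX -exprS.
have mu_rec (s U : {vspace 'rV[F]_n}) : tot_isotropic P U -> (s <= U)%VS ->
    \dim U = (\dim s).+1 ->
  q * (mu (\dim U) - #|[set X : {vspace 'rV[F]_n} |
     [&& (s <= X)%VS, \dim X == (\dim s).+1 &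
         tot_isotropic P X && ~~ (X <= perp P U)%VS]]|%:R) = mu (\dim s).
  move=> tiU sU dU; have tis := ti_sub ndP sU tiU.
  rewrite dU /mu /f exprS; apply: level_eigenvalue_rec => //.
  have := congr1 (fun m : nat => m%:R : R) (card_opposite_covers ndP tiU sU).
  by rewrite natrD natrM dq !sing // dU (exprS _ (\dim s)).
have lam_rec (s : {vspace 'rV[F]_n}) : tot_isotropic P s ->
    #|[set X : {vspace 'rV[F]_n} | (X <= s)%VS && ((\dim X).+1 == \dim s)]|%:R
    - #|[set X : {vspace 'rV[F]_n} |
         [&& (s <= X)%VS, \dim X == (\dim s).+1 & tot_isotropic P X]]|%:R =
    lam (\dim s) - lam (\dim s).+1 - mu (\dim s).
  move=> tis; rewrite /lam /mu /f [q ^+ _.+1]exprS; apply: level_shift_rec => //.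
    have := card_hyperplanes (sub0v s); rewrite dimv0 subn0.
    move/(congr1 (fun m : nat => m%:R : R)).
    rewrite natrM !natrB ?expn_gt0 ?(ltnW (finNzRing_gt1 F)) // natrX => <-.
    by congr (_%:R * _); apply: eq_card => X; rewrite !inE sub0v.
  have := congr1 (fun m : nat => m%:R : R) (card_ti_covers ndP tis).
  by rewrite natrD natrM dq natrX sing.
(* With these two zeros [X] acts as [U^T *m U] on level r, and [X - B] as [U *m U^T] on level d-i,
   where its shift is [lam] one level higher. *)
have lam_r : lam r = 0.
  by rewrite /lam /f /level_shift subrr !mul0r oppr0 mul0r.
have lam_di : lam (d - i).+1 = 0.
  rewrite /lam /f /level_shift exprS [q ^+ (d - i)](_ : _ = q ^+ d / q ^+ i).
    by rewrite mulrA subrr mulr0 mul0r oppr0 mul0r.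
  by apply: (canRL (mulfK _)); rewrite ?gt_eqF // -exprD subnK //; lia.
apply/rV_subP => v; rewrite /Vsp !sub_capmx => /andP[/andP[/andP[vr vr1] vd] vd1].
apply/eigenspaceP.
have orthcE b : (v <= orthc (image_mx (Cinc P R b a)))%MS -> v *m Cinc P R b a = 0.
  by move/sub_kermxP; rewrite mul1mx map_mx_id // trmxK.
move: vr vd => /submxP[w vw] /submxP[z vz].
rewrite /image_mx !Cinc_tr // in vw vz.
pose J b := Omega_mx P R b.
have vJ_B : v *m J a *m (opposite_mx R P - level_mx P mu) = 0.
  (* The first two passages, from r up to a and from d-i down to a, produce v. The last two go one
     step further, to r-1 and d-i+1, where the orthogonality conditions in [Vsp] give 0. *)
  have [g1 g1_neq0 e1] := Omega_mx_up ndP R r (a - r).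
  have [g2 g2_neq0 e2] := Omega_mx_down ndP R (d - i)%N (d - i - a).
  have [g3 _ e3] := Omega_mx_down ndP R a (a - r).+1.
  have [g4 _ e4] := Omega_mx_up ndP R a (d - i - a).+1.
  have ar : r%:Z + (a - r)%:Z = a by lia.
  have da : (d - i)%N%:Z - (d - i - a)%:Z = a by lia.
  have r1 : a%:Z - (a - r).+1%:Z = r%:Z - 1 by lia.
  have d1 : a%:Z + (d - i - a).+1%:Z = d%:Z - i%:Z + 1 by lia.
  rewrite ar in e1; rewrite da in e2; rewrite r1 in e3; rewrite d1 in e4.
  have di : d%:Z - i%:Z = (d - i)%N by lia.
  move: z vz; rewrite di => z vz.
  have XB := down_sub_up ndP lam_rec.
  have BU := opposite_cover ndP mu_rec.
  have Btr := shifted_opposite_tr P mu.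
  have LU := @cover_level R F n P.
  set U := cover_mx R P in XB BU LU e1 e2 e3 e4 *.
  set B := opposite_mx R P - level_mx P mu in XB BU Btr *.
  set X := U^T *m U - level_mx P lam in XB *.
  have Xtr : X^T = X.
    by rewrite /X linearB /= trmx_mul trmxK level_mx_tr.
  have UX : U *m X = (X - B) *m U.
    by rewrite XB mulmxBr mulmxBl LU !mulmxA.
  apply: (@up_down_eigen R _ _ q U B X (a - r) (d - i - a)
    (g1^-1 *: (w *m J r)) (g2^-1 *: (z *m J (d - i)%N))) => //.
  - apply: trmx_inj; rewrite trmx_mul trmxK Btr BU linearZ /= trmx_mul trmxK Btr.
    by [].
  - by apply: trmx_inj; rewrite !trmx_mul trmxK [(X - B)^T]linearB /= Xtr Btr UX.
  - by rewrite -scalemxAl -mulmxA e1 -scalemxAr scalerA mulVf // scale1r mulmxA -vw.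
  - rewrite -!scalemxAl -[w *m J r *m X]mulmxA [J r *m X]mulmxBr.
    rewrite (@Omega_mx_level F n P R _ _ 0) => [|k [->]] //.
    by rewrite scale0r subr0 !mulmxA.
  - by rewrite -mulmxA e3 -scalemxAr mulmxA orthcE // mul0mx scaler0.
  - by rewrite -scalemxAl -mulmxA e2 -scalemxAr scalerA mulVf // scale1r mulmxA -vz.
  - rewrite XB -!scalemxAl -[z *m J _ *m (_ - _)]mulmxA [J _ *m (_ - _)]mulmxBr.
    rewrite (@Omega_mx_level F n P R _ _ 0) => [|k [->]] //.
    by rewrite scale0r subr0 !mulmxA.
  - by rewrite -mulmxA e4 -scalemxAr mulmxA orthcE // mul0mx scaler0.
(* On level a the matrix [level_mx P mu] is the scalar [mu a], so [vJ_B] is the eigenvector equation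
   after extension by zero; [Omega_mxK] then removes the extension. *)
have : v *m (Crel P R a a (a%:Z - 1) a)^T *m J a = mu a *: v *m J a.
  rewrite -mulmxA Crel_Omega_mx // mulmxA.
  move: vJ_B; rewrite mulmxBr => /eqP; rewrite subr_eq0 => /eqP ->.
  rewrite -mulmxA (@Omega_mx_level F n P R _ _ (mu a)) => [|k [->]] //.
  by rewrite -scalemxAr -scalemxAl.
move/(congr1 (mulmx^~ (J a)^T)); rewrite -!mulmxA Omega_mxK // !mulmx1.
by [].
Qed.
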